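(* Let $\mathbb{X}=\mathbb{R}^d$ with $c(x,y)=|x-y|^2$, let $\mu,\nu\in\mathcal{P}(\mathbb{R}^d)$ have finite second moment, let $\varepsilon>0$, and let $\lambda$ be the Lebesgue measure on $\mathbb{R}^d$. For $t\in(0,1)$ set $\psi_t(x,z)=|x-z|^2/t$ and let $\eta_t\in\mathcal{P}(\mathbb{R}^d)$ be the unique minimizer over $\eta\in\mathcal{P}(\mathbb{R}^d)$ of $$\mathcal{F}_t(\eta):=\mathrm{OT}^\varepsilon_{\psi_t}(\mu,\eta)+\mathrm{OT}^\varepsilon_{\psi_{1-t}}(\nu,\eta)+\varepsilon\,\mathrm{KL}(\eta|\lambda).$$ Then $\eta_t=\rho^{SB}_t$, the time-$t$ marginal of the Schrödinger bridge between $\mu$ and $\nu$ whose reference process is the Brownian motion on $\mathbb{R}^d$ with transition kernel $p_t(x,y)=(\pi\varepsilon t)^{-d/2}\exp\big(-\frac{|x-y|^2}{t\varepsilon}\big)$.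
   Context: $\mathcal{P}(\mathbb{R}^d)$: Borel probability measures; $\Pi(\mu,\eta)$: couplings. $\mathrm{KL}(\mu|\nu)=\int\log\frac{d\mu}{d\nu}\,d\mu$ if $\mu\ll\nu$, $+\infty$ otherwise (also used with $\nu=\lambda$ Lebesgue measure). For a cost $b$, $\mathrm{OT}^\varepsilon_b(\mu,\eta)=\inf_{\pi\in\Pi(\mu,\eta)}\int b\,d\pi+\varepsilon\,\mathrm{KL}(\pi|\mu\otimes\eta)$. Let $\pi^*\in\Pi(\mu,\nu)$ be the unique optimal plan of $\mathrm{OT}^\varepsilon_c(\mu,\nu)$; it has the form $d\pi^*(x,y)=e^{\frac{u(x)+v(y)-|x-y|^2}{\varepsilon}}d\mu(x)\,d\nu(y)$ with $u,v$ the optimal entropic potentials. The time-$t$ marginal of the Schrödinger bridge (the entropic interpolant) is the probability measure with Lebesgue density $$\rho^{SB}_t(z)=\int_{\mathbb{R}^d\times\mathbb{R}^d}\frac{p_t(x,z)\,p_{1-t}(z,y)}{p_1(x,y)}\,d\pi^*(x,y),$$ i.e. the Schrödinger bridge is the mixture over $\pi^*$ of the Brownian bridges of the reference process. *)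

(* Defs.v *)
From HB Require Import structures.
From mathcomp Require Import all_boot all_order all_algebra.
From mathcomp Require Import all_classical all_reals all_analysis.

Set Implicit Arguments.
Unset Strict Implicit.
Unset Printing Implicit Defensive.

Import Order.TTheory GRing.Theory Num.Theory.
Import numFieldNormedType.Exports.

Local Open Scope classical_set_scope.
Local Open Scope ring_scope.
Local Open Scope ereal_scope.

(* R^n is the type of n-tuples of reals with the product sigma-algebra, which
   is the Borel sigma-algebra of R^n. *)
Notation Rn R n := (n.-tuple (measurableTypeR R)).

Section lebesgue_measure_Rn.
Context (R : realType).

Definition cons_Rn n (p : measurableTypeR R * Rn R n) : Rn R n.+1 :=
  [tuple of p.1 :: p.2].

Lemma measurable_cons_Rn n : measurable_fun [set: _] (@cons_Rn n).
Proof. exact: measurable_cons. Qed.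

Section succ.
Variables (n : nat) (m : {sigma_finite_measure set (Rn R n) -> \bar R}).

Definition lebesgue_Rn_succ : set (Rn R n.+1) -> \bar R :=
  pushforward (@lebesgue_measure R \x m) (@cons_Rn n).

Let succ0 : lebesgue_Rn_succ set0 = 0.
Proof. by rewrite /lebesgue_Rn_succ /pushforward preimage_set0 measure0. Qed.

Let succ_ge0 A : 0 <= lebesgue_Rn_succ A.
Proof. exact: (measure_ge0 (@lebesgue_measure R \x m)%E). Qed.

Let succ_sigma_additive : semi_sigma_additive lebesgue_Rn_succ.
Proof.
move=> F mF tF mUF; rewrite /lebesgue_Rn_succ /pushforward preimage_bigcup.
have mc X : measurable X -> measurable (@cons_Rn n @^-1` X).
  by move=> mX; rewrite -[Y in measurable Y]setTI; exact: measurable_cons_Rn.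
apply: (@measure_semi_sigma_additive _ _ _ (@lebesgue_measure R \x m)%E (fun k => @cons_Rn n @^-1` F k)).
- by move=> k; exact: mc.
- apply/trivIsetP => /= i j _ _ ij; rewrite -preimage_setI.
  by move/trivIsetP : tF => /(_ _ _ _ _ ij) ->//; rewrite preimage_set0.
- by rewrite -preimage_bigcup; exact: mc.
Qed.

HB.instance Definition _ := isMeasure.Build _ _ _ lebesgue_Rn_succ
  succ0 succ_ge0 succ_sigma_additive.

Let succ_sigma_finite : sigma_finite setT lebesgue_Rn_succ.
Proof.
have /sigma_finiteP[F [TF ndF Foo]] := sigma_finiteT (@lebesgue_measure R).
have /sigma_finiteP[G [TG ndG Goo]] := sigma_finiteT m.
pose h (x : Rn R n.+1) : measurableTypeR R * Rn R n :=
  (tnth x ord0, [tuple of behead x]).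
have hK : cancel (@cons_Rn n) h.
  by move=> [a b]; rewrite /h /cons_Rn /=; congr pair; apply/val_inj.
have mh : measurable_fun setT h.
  apply/measurable_fun_pair; first exact: measurable_tnth.
  exact: measurable_behead.
exists (fun k => h @^-1` (F k `*` G k)).
  rewrite -preimage_bigcup (_ : \bigcup_k _ = setT) ?preimage_setT//.
  rewrite -subTset => -[a b] _.
  have [k _ Fka] : (\bigcup_k F k) a by rewrite -TF.
  have [l _ Glb] : (\bigcup_k G k) b by rewrite -TG.
  exists (maxn k l) => //; split.
  - by move: a Fka; exact/subsetPset/ndF/leq_maxl.
  - by move: b Glb; exact/subsetPset/ndG/leq_maxr.
move=> k; have [mF Fy] := Foo k; have [mG Gy] := Goo k; split.
  by rewrite -[X in measurable X]setTI; apply: mh => //; exact: measurableX.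
rewrite /lebesgue_Rn_succ /pushforward -comp_preimage.
rewrite (_ : h \o _ = id) ?preimage_id; last by apply/funext => x; exact: hK.
by rewrite product_measure1E// lte_mul_pinfty// ge0_fin_numE.
Qed.

HB.instance Definition _ := Measure_isSigmaFinite.Build _ _ _ lebesgue_Rn_succ
  succ_sigma_finite.

End succ.

(* Built by transporting lebesgue_measure \x lebesgue_Rn n along cons_Rn;
   lebesgue_Rn_box shows that it is the Lebesgue measure. *)
Fixpoint lebesgue_Rn n : {sigma_finite_measure set (Rn R n) -> \bar R} :=
  match n with
  | 0%N => @dirac _ (Rn R 0) [tuple] R
  | n'.+1 => lebesgue_Rn_succ (lebesgue_Rn n')
  end.

Lemma lebesgue_Rn_box n (A : 'I_n -> set (measurableTypeR R)) :
  (forall i, measurable (A i)) ->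
  lebesgue_Rn n [set x | forall i, A i (tnth x i)] =
  \prod_(i < n) lebesgue_measure (A i).
Proof.
elim: n A => [|n IH] A mA.
  rewrite big_ord0 /= diracE mem_set//; by case.
rewrite big_ord_recl -IH//=.
rewrite /lebesgue_Rn_succ /pushforward -product_measure1E//; last first.
  rewrite (_ : [set _ | _] = \bigcap_(i in [set: 'I_n])
      ((fun x : Rn R n => tnth x i) @^-1` A (lift ord0 i))).
    apply: fin_bigcap_measurable => // i _.
    by rewrite -[X in measurable X]setTI; exact: measurable_tnth.
  by apply/seteqP; split => x /= h i; [move=> _; exact: h|exact: h].
congr (_ _); apply/seteqP; split => -[a b] /=.
  move=> h; split; first exact: (h ord0).
  by move=> i; have := h (lift ord0 i); rewrite /cons_Rn tnthS.
move=> [ha hb] i; case: (unliftP ord0 i) => [j|] ->.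
  by rewrite /cons_Rn tnthS; exact: hb.
exact: ha.
Qed.

End lebesgue_measure_Rn.

Section entropic_optimal_transport.
Context (R : realType).

(* The density is evaluated only where mu `<< nu, and lne 0 = -oo only matters
   on a mu-null set. When nu is infinite, both parts of the integrand can have
   infinite integral; the integral is then -oo. See barycenter_functional. *)
Definition KL d (T : measurableType d) (mu : probability T R)
    (nu : {sigma_finite_measure set T -> \bar R}) : \bar R :=
  if `[< mu `<< nu >] then
    \int[mu]_x lne (Radon_Nikodym_SigmaFinite.f mu nu x)
  else +oo.

Definition is_coupling d1 d2 (T1 : measurableType d1) (T2 : measurableType d2)
    (mu : probability T1 R) (eta : probability T2 R)
    (P : probability (T1 * T2)%type R) : Prop :=
  (forall A, measurable A -> pushforward P fst A = mu A) /\
  (forall B, measurable B -> pushforward P snd B = eta B).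

Definition eot_cost d1 d2 (T1 : measurableType d1) (T2 : measurableType d2)
    (eps : R) (b : T1 -> T2 -> R) (mu : probability T1 R)
    (eta : probability T2 R) (P : probability (T1 * T2)%type R) : \bar R :=
  \int[P]_q (b q.1 q.2)%:E +
  eps%:E * KL P ((mu \x eta) : probability (T1 * T2)%type R).

Definition EOT d1 d2 (T1 : measurableType d1) (T2 : measurableType d2)
    (eps : R) (b : T1 -> T2 -> R) (mu : probability T1 R)
    (eta : probability T2 R) : \bar R :=
  ereal_inf [set eot_cost eps b mu eta P | P in is_coupling mu eta].

Definition is_optimal_plan d1 d2 (T1 : measurableType d1)
    (T2 : measurableType d2) (eps : R) (b : T1 -> T2 -> R)
    (mu : probability T1 R) (eta : probability T2 R)
    (P : probability (T1 * T2)%type R) : Prop :=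
  is_coupling mu eta P /\ eot_cost eps b mu eta P = EOT eps b mu eta.

Definition is_minimizer d (T : measurableType d)
    (F : probability T R -> \bar R) (eta : probability T R) : Prop :=
  forall eta', F eta <= F eta'.

(* Uniqueness is up to equality on measurable sets: the values of a Rocq
   measure outside of the sigma-algebra are irrelevant. *)
Definition is_unique_minimizer d (T : measurableType d)
    (F : probability T R -> \bar R) (eta : probability T R) : Prop :=
  is_minimizer F eta /\
  forall eta', is_minimizer F eta' ->
    forall A, measurable A -> eta' A = eta A.

Definition has_density d (T : measurableType d) (eta : probability T R)
    (nu : {sigma_finite_measure set T -> \bar R}) (f : T -> \bar R) : Prop :=
  forall A, measurable A -> eta A = \int[nu]_(x in A) f x.

End entropic_optimal_transport.

Section euclidean.
Context (R : realType) (d : nat).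
Implicit Types (x y z : Rn R d) (eps t : R).

Definition sqdist x y : R := (\sum_(i < d) (tnth x i - tnth y i) ^+ 2)%R.

Definition finite_second_moment (mu : probability (Rn R d) R) : Prop :=
  \int[mu]_x (\sum_(i < d) tnth x i ^+ 2)%R%:E < +oo.

Definition psi t x z : R := (sqdist x z / t)%R.

(* The last sum uses the dual addition, for which +oo + -oo = +oo: the value is
   +oo as soon as a transport cost is +oo, even where the entropy of eta
   relative to the Lebesgue measure is -oo or undefined (which forces eta to
   have infinite second moment, hence infinite transport costs). *)
Definition barycenter_functional eps t (mu nu : probability (Rn R d) R)
    (eta : probability (Rn R d) R) : \bar R :=
  ((EOT eps (psi t) mu eta + EOT eps (psi (1 - t)) nu eta)%E
   + (eps%:E * KL eta (lebesgue_Rn R d))%E)%dE.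

Definition heat_kernel eps t x y : R :=
  ((pi * eps * t) `^ (- (d%:R / 2)) * expR (- (sqdist x y / (t * eps))))%R.

(* Mixture over P of the time-t densities of the Brownian bridges. *)
Definition rho_SB eps t (P : probability (Rn R d * Rn R d)%type R) z : \bar R :=
  \int[P]_q (heat_kernel eps t q.1 z * heat_kernel eps (1 - t) z q.2
             / heat_kernel eps 1 q.1 q.2)%R%:E.

End euclidean.

(* Main.v *)
From HB Require Import structures.
Require Import Defs.
From mathcomp Require Import all_boot all_order all_algebra.
From mathcomp Require Import all_classical all_reals all_analysis.
From mathcomp Require Import measurable_realfun ring lra.

(** Gluing a coupling of [mu] with [eta] and a coupling of [nu] with [eta] along
    [eta] gives a law [Q] of triples [(x, y, z)] under which [x] and [y] are
    conditionally independent given [z]. If [f1], [f2] and [h] are the densities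
    of the two couplings and of [eta], then [Q] has density
    [f1 (x, z) * f2 (y, z) * h z] with respect to the product of [mu], [nu] and
    the Lebesgue measure, so that the three relative entropies in the functional
    add up to the entropy of [Q]. Completing the square,
<<
      |x - z|^2 / t + |y - z|^2 / (1 - t)
        = |x - y|^2 + |z - ((1 - t) x + t y)|^2 / (t (1 - t)),
>>
    and the last term is [- eps] times the logarithm of the density [bridge] of
    the Brownian bridge from [x] to [y] at time [t], up to a constant
    ([psi_bridge]). Up to that constant, the three terms of the functional are
    thus the expectation of [|x - y|^2] under [Q] plus [eps] times the entropy of
    [Q] relative to the law that draws the endpoints from [mu] and [nu]
    independently and the midpoint from the bridge ([exists_near_plan]).

    Conditionally on the endpoints the entropy relative to the bridge is
    nonnegative, so this quantity is at least the entropic cost of the endpoint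
    marginal of [Q], hence at least the optimal cost between [mu] and [nu]
    ([plan_cost_ge_EOT]). Filling the optimal plan [pi_star] with bridges
    reaches that bound ([optimal_bridge_mixture]), and the functional at the
    midpoint marginal of any plan is at most the cost of the plan, because a
    conditional mutual information is nonnegative ([interpolation_le]). Hence
    the midpoint marginal of this mixture is a minimizer, and by Tonelli's
    theorem its density is [rho_SB].

    Uniqueness is strict convexity made quantitative, so that it applies to
    near-optimal couplings. A minimizer is the midpoint marginal of plans whose
    cost is as close as desired to the minimum; the average of such a plan with
    the optimal mixture is again a plan, and the gap in the convexity inequality,
    a relative entropy, bounds the difference of the probabilities that both give
    to any event ([entropy_ge_event], [plan_stability]).

    All of this rests on Gibbs' inequality, that is on [ln u <= u - 1]. It also
    makes each entropy integrable from one side, which is how infinite and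
    undefined integrals are excluded. The argument is carried out for abstract
    costs and an abstract bridge kernel ([interpolation_minimizer]); the
    Euclidean case then only requires Gaussian integrals. *)

Set Implicit Arguments.
Unset Strict Implicit.
Unset Printing Implicit Defensive.

(** * Expectations of real functions *)

Section expectation.
Import Order.TTheory GRing.Theory Num.Theory.
Local Open Scope classical_set_scope.
Local Open Scope ring_scope.
Local Open Scope ereal_scope.
Context d (T : measurableType d) (R : realType) (Q : {measure set T -> \bar R}).

Definition has_expect (f : T -> R) := Q.-integrable setT (EFin \o f).

Definition expect (f : T -> R) : R := fine (\int[Q]_x (f x)%:E).

Implicit Types f g : T -> R.

Lemma has_expect_measurable f : has_expect f -> measurable_fun setT f.
Proof. by move=> /measurable_int/measurable_EFinP. Qed.

Lemma expectE f : has_expect f -> (expect f)%:E = \int[Q]_x (f x)%:E.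
Proof. by move=> f1; rewrite /expect fineK//; exact: integrable_fin_num. Qed.

Lemma has_expectD f g : has_expect f -> has_expect g ->
  has_expect (f \+ g)%R.
Proof. by move=> f1 g1; apply: eq_integrable (integrableD _ f1 g1). Qed.

Lemma has_expectN f : has_expect f -> has_expect (fun x => - f x)%R.
Proof. by move=> f1; apply: eq_integrable (integrableN f1). Qed.

Lemma has_expectB f g : has_expect f -> has_expect g ->
  has_expect (f \- g)%R.
Proof. by move=> f1 g1; apply: eq_integrable (integrableB _ f1 g1). Qed.

Lemma has_expectZ (k : R) f : has_expect f ->
  has_expect (fun x => k * f x)%R.
Proof. by move=> f1; apply: eq_integrable (integrableZl _ k f1). Qed.

Lemma expectD f g : has_expect f -> has_expect g ->
  expect (f \+ g)%R = (expect f + expect g)%R.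
Proof. by move=> f1 g1; rewrite /expect; exact: RintegralD. Qed.

Lemma expectB f g : has_expect f -> has_expect g ->
  expect (f \- g)%R = (expect f - expect g)%R.
Proof. by move=> f1 g1; rewrite /expect; exact: RintegralB. Qed.

Lemma expectZ (k : R) f : has_expect f ->
  expect (fun x => k * f x)%R = (k * expect f)%R.
Proof. by move=> f1; rewrite /expect; exact: RintegralZl. Qed.

Lemma expect_ae f g : measurable_fun setT f -> measurable_fun setT g ->
  {ae Q, forall x, f x = g x} -> expect f = expect g.
Proof.
move=> mf mg fg; congr fine; apply: ae_eq_integral => //;
  [exact/measurable_EFinP..|].
by move: fg; apply: filterS => x /= ->.
Qed.

(** Integrability of entropies is always obtained by trapping them between two
    integrable functions. *)
Lemma has_expect_between l f u : measurable_fun setT f ->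
  has_expect l -> has_expect u ->
  {ae Q, forall x, (l x <= f x <= u x)%R} -> has_expect f.
Proof.
move=> mf l1 u1 lfu; apply/integrableP; split; first exact/measurable_EFinP.
have ml := has_expect_measurable l1; have mu := has_expect_measurable u1.
have lu1 : has_expect (fun x => `|l x| + `|u x|)%R.
  by apply: has_expectD; [exact: (integrable_norm l1)|exact: (integrable_norm u1)].
apply: (@le_lt_trans _ _ (\int[Q]_x (`|l x| + `|u x|)%:E)); last first.
  by apply: integrable_lty lu1.
apply: ae_ge0_le_integral => //.
- by apply/measurable_EFinP; exact: measurableT_comp.
- exact/measurable_EFinP/has_expect_measurable/lu1.
- move: lfu; apply: filterS => x /andP[lf fu] _ /=; rewrite lee_fin ler_norml.
  have := ler_norm (u x); have := ler_norm (- l x); rewrite normrN.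
  have := normr_ge0 (u x); have := normr_ge0 (l x); lra.
Qed.

Lemma has_expect_ae f g : measurable_fun setT g -> has_expect f ->
  {ae Q, forall x, f x = g x} -> has_expect g.
Proof.
move=> mg f1 fg; apply: (has_expect_between mg f1 f1).
by move: fg; apply: filterS => x ->; rewrite lexx.
Qed.

Lemma le_expect f g : has_expect f -> has_expect g ->
  {ae Q, forall x, (f x <= g x)%R} -> (expect f <= expect g)%R.
Proof.
move=> f1 g1 fg; rewrite -subr_ge0 -expectB//.
have h1 : has_expect (fun x => Num.max 0 (g x - f x))%R.
  apply: (has_expect_between _ (has_expectB g1 f1) (integrable_norm (has_expectB g1 f1))).
    by apply: measurable_maxr => //; exact/has_expect_measurable/has_expectB.
  by apply: aeW => x /=; rewrite le_max lexx orbT ge_max normr_ge0 ler_norm.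
rewrite (@expect_ae _ (fun x => Num.max 0 (g x - f x))%R).
- by apply: fine_ge0; apply: integral_ge0 => x _; rewrite lee_fin le_max lexx.
- exact/has_expect_measurable/has_expectB.
- exact: has_expect_measurable.
- by move: fg; apply: filterS => x fg /=; rewrite max_r// subr_ge0.
Qed.

Lemma ge0_has_expect f : measurable_fun setT f -> (forall x, 0 <= f x)%R ->
  \int[Q]_x (f x)%:E < +oo -> has_expect f.
Proof.
move=> mf f0 foo; apply/integrableP; split; first exact/measurable_EFinP.
by under eq_integral do rewrite /= ger0_norm//.
Qed.

Lemma expect_le_ge0 f (c : R) : \int[Q]_x (f x)%:E <= c%:E ->
  has_expect f -> (expect f <= c)%R.
Proof. by move=> + f1; rewrite -expectE// lee_fin. Qed.

End expectation.

Section expectation_law.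
Import Order.TTheory GRing.Theory Num.Theory.
Local Open Scope classical_set_scope.
Local Open Scope ring_scope.
Local Open Scope ereal_scope.

Lemma has_expect_cst d (T : measurableType d) (R : realType)
  (Q : probability T R) (k : R) : has_expect Q (fun=> k).
Proof. exact: finite_measure_integrable_cst. Qed.

Lemma expect_cst d (T : measurableType d) (R : realType)
  (Q : probability T R) (k : R) : expect Q (fun=> k) = k.
Proof.
by rewrite /expect integral_cst//= [X in _ * X](@probability_setT _ _ _ Q) mule1.
Qed.

Context d1 d2 (T1 : measurableType d1) (T2 : measurableType d2) (R : realType).

Definition has_law (Q : probability T1 R) (phi : T1 -> T2)
    (P : probability T2 R) :=
  forall A, measurable A -> Q (phi @^-1` A) = P A.

Lemma exists_law (Q : probability T1 R) (phi : T1 -> T2) :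
  measurable_fun setT phi -> exists P, has_law Q phi P.
Proof.
move=> mphi.
pose X : {mfun T1 >-> T2} := HB.pack phi (isMeasurableFun.Build _ _ _ _ _ mphi).
by exists (distribution Q X).
Qed.

Variables (Q : probability T1 R) (phi : T1 -> T2) (P : probability T2 R).
Hypotheses (mphi : measurable_fun setT phi) (QP : has_law Q phi P).

Lemma ge0_integral_law (G : T2 -> \bar R) : measurable_fun setT G ->
  (forall x, 0 <= G x) -> \int[Q]_x G (phi x) = \int[P]_y G y.
Proof.
move=> mG G0; rewrite -[LHS](@ge0_integral_pushforward _ _ _ _ _ _ mphi Q setT G)//.
by apply: eq_measure_integral => A mA _; exact: QP.
Qed.

Lemma has_expect_law (f : T2 -> R) : measurable_fun setT f ->
  has_expect Q (f \o phi) <-> has_expect P f.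
Proof.
move=> mf; have e : \int[Q]_x `|(f (phi x))%:E| = \int[P]_x `|(f x)%:E|.
  rewrite (ge0_integral_law (G := fun y => `|(f y)%:E|))//.
  by apply: measurableT_comp => //; exact/measurable_EFinP.
split=> /integrableP[_ h]; apply/integrableP; split.
- exact/measurable_EFinP.
- by rewrite -e.
- by apply/measurable_EFinP; exact: measurableT_comp.
- by rewrite /comp e.
Qed.

Lemma integral_law (f : T2 -> R) : measurable_fun setT f ->
  \int[Q]_x (f (phi x))%:E = \int[P]_x (f x)%:E.
Proof.
move=> mf; rewrite integralE [RHS]integralE; congr (_ - _).
  rewrite -(ge0_integral_law (G := fun y => (EFin \o f)^\+ y))//.
    by apply: eq_integral => x _; rewrite /= !funeposE.
  by apply: (@measurable_funepos _ _ _ _ (EFin \o f)); exact/measurable_EFinP.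
rewrite -(ge0_integral_law (G := fun y => (EFin \o f)^\- y))//.
  by apply: eq_integral => x _; rewrite /= !funenegE.
by apply: (@measurable_funeneg _ _ _ _ (EFin \o f)); exact/measurable_EFinP.
Qed.

Lemma expect_law (f : T2 -> R) : measurable_fun setT f ->
  expect Q (f \o phi) = expect P f.
Proof. by move=> mf; congr fine; exact: integral_law. Qed.

Lemma ae_law (p : T2 -> Prop) : {ae P, forall y, p y} ->
  {ae Q, forall x, p (phi x)}.
Proof.
move=> [N [mN N0 pN]]; exists (phi @^-1` N); split => //.
- by rewrite -[X in measurable X]setTI; exact: mphi.
- by rewrite -N0; exact: QP.
- by move=> x /= h; apply: pN.
Qed.

Lemma law_of_integral :
  (forall G : T2 -> \bar R, measurable_fun setT G -> (forall y, 0 <= G y) ->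
    \int[Q]_x G (phi x) = \int[P]_y G y) -> has_law Q phi P.
Proof.
move=> QPG A mA; have mphiA : measurable (phi @^-1` A).
  by rewrite -[X in measurable X]setTI; exact: mphi.
rewrite -[phi @^-1` A]setIT -integral_indic//.
rewrite -[in RHS](setIT A) -[RHS]integral_indic//.
rewrite -(QPG (fun y => (\1_A y)%:E))//.
- exact/measurable_EFinP/measurable_indic.
Qed.

End expectation_law.

Lemma has_law_comp d1 d2 d3 (T1 : measurableType d1) (T2 : measurableType d2)
    (T3 : measurableType d3) (R : realType) (Q : probability T1 R)
    (phi : T1 -> T2) (psi : T2 -> T3) (P : probability T2 R)
    (S : probability T3 R) : measurable_fun setT psi ->
  has_law Q phi P -> has_law P psi S -> has_law Q (psi \o phi) S.
Proof.
move=> mpsi QP PS A mA; rewrite -PS// -QP// -[X in measurable X]setTI.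
exact: mpsi.
Qed.

(** * Densities and Gibbs' inequality *)

Section density.
Import Order.TTheory GRing.Theory Num.Theory.
Local Open Scope classical_set_scope.
Local Open Scope ring_scope.
Local Open Scope ereal_scope.
Context d (T : measurableType d) (R : realType).
Implicit Types (Q : probability T R) (q r f : T -> R).

Record is_density (m : {measure set T -> \bar R}) Q q : Prop := IsDensity {
  density_measurable : measurable_fun setT q ;
  density_ge0 : forall x, (0 <= q x)%R ;
  density_prob : forall A, measurable A -> Q A = \int[m]_(x in A) (q x)%:E }.

Lemma measurable_fun_ln f : measurable_fun setT f ->
  measurable_fun setT (fun x => ln (f x)).
Proof. by move=> mf; apply: measurableT_comp. Qed.

(** An integrable lower bound rules out the value [-oo] and the undefined form
    in the integral, which then is finite as soon as it is not [+oo]. *)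
Lemma has_expect_lty Q l f : measurable_fun setT f -> has_expect Q l ->
  {ae Q, forall x, (l x <= f x)%R} -> \int[Q]_x (f x)%:E < +oo ->
  has_expect Q f.
Proof.
move=> mf l1 lf foo; have mef : measurable_fun setT (EFin \o f).
  exact/measurable_EFinP.
have n_lty : \int[Q]_x (EFin \o f)^\- x < +oo.
  apply: (le_lt_trans _ (integrable_lty measurableT (integrable_norm l1))).
  apply: ae_ge0_le_integral => //.
  - exact: measurable_funeneg.
  - by move=> x _; rewrite lee_fin normr_ge0.
  - apply/measurable_EFinP/measurableT_comp => //.
    exact: (has_expect_measurable l1).
  move: lf; apply: filterS => x lf _ /=.
  rewrite funenegE /= -EFin_max lee_fin ge_max normr_ge0 andbT.
  have := ler_norm (- l x)%R; rewrite normrN; lra.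
have p_lty : \int[Q]_x (EFin \o f)^\+ x < +oo.
  move: foo n_lty; rewrite integralE.
  have := @integral_ge0 _ _ _ Q setT (EFin \o f)^\- (fun x _ => funeneg_ge0 _ x).
  case: (\int[Q]_x (EFin \o f)^\- x) => [n| |]// _.
  case: (\int[Q]_x (EFin \o f)^\+ x) => [p| |]//= _ _.
  exact: ltry.
apply/integrableP; split => //.
rewrite (_ : (fun x => _) = (EFin \o f)^\+ \+ (EFin \o f)^\-); last first.
  exact: (fune_abse (EFin \o f)).
rewrite ge0_integralD//; [exact: lte_add_pinfty|exact: measurable_funepos|].
exact: measurable_funeneg.
Qed.

Lemma exists_density (m : {measure set T -> \bar R}) q :
  measurable_fun setT q -> (forall x, 0 <= q x)%R -> \int[m]_x (q x)%:E = 1 ->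
  exists Q, is_density m Q q.
Proof.
move=> mq q0 q1.
pose Q (A : set T) := \int[m]_(x in A) (q x)%:E.
have Q0 : Q set0 = 0 by rewrite /Q integral_set0.
have Qge0 A : 0 <= Q A by apply: integral_ge0 => x _; rewrite lee_fin.
have Qadd : semi_sigma_additive Q.
  move=> F mF tF mUF; rewrite [X in _ --> X](_ : _ = \sum_(n <oo) Q (F n)).
    by apply/cvg_closeP; split; [exact: is_cvg_nneseries|rewrite closeE].
  rewrite /Q ge0_integral_bigcup//; last by move=> x _; rewrite lee_fin.
  by apply/measurable_EFinP; exact: measurable_funTS.
pose Qm : {measure set T -> \bar R} :=
  HB.pack Q (isMeasure.Build _ _ _ Q Q0 Qge0 Qadd).
pose Qp : probability T R :=
  HB.pack Q Qm (Measure_isProbability.Build _ _ _ Qm q1).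
by exists Qp; split.
Qed.

Section sigma_finite_reference.
Variable m : {sigma_finite_measure set T -> \bar R}.

Lemma density_dominates Q q : is_density m Q q -> Q `<< m.
Proof.
case=> mq q0 Qq; apply/null_content_dominatesP => A mA mA0.
rewrite Qq//; apply: null_set_integral => //.
by apply/measurable_EFinP; exact: measurable_funTS.
Qed.

(** The density agrees almost everywhere with the Radon-Nikodym derivative, for
    which the change of variables is known. *)
Lemma density_integral Q q (G : T -> \bar R) : is_density m Q q ->
  measurable_fun setT G -> (forall x, 0 <= G x) ->
  \int[Q]_x G x = \int[m]_x (G x * (q x)%:E).
Proof.
move=> dq mG G0; have Qm := density_dominates dq; case: dq => mq q0 Qq.
rewrite -(Radon_Nikodym_SigmaFinite.change_of_variables Qm G0)//.
have mf := measurable_int _ (Radon_Nikodym_SigmaFinite.f_integrable Qm).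
apply: ae_eq_integral => //.
- exact: emeasurable_funM.
- by apply: emeasurable_funM => //; exact/measurable_EFinP.
have : ae_eq m setT (Radon_Nikodym_SigmaFinite.f Q m) (EFin \o q).
  apply: integral_ae_eq => //.
  - exact: Radon_Nikodym_SigmaFinite.f_integrable.
  - exact/measurable_EFinP.
  - move=> E _ mE; rewrite -Radon_Nikodym_SigmaFinite.f_integral//.
    exact: Qq.
by apply: filterS => x /= h _; rewrite h.
Qed.

Lemma density_integral1 Q q : is_density m Q q -> \int[m]_x (q x)%:E = 1.
Proof. by case=> _ _ <-//; exact: probability_setT. Qed.

Lemma density_gt0_ae Q q : is_density m Q q -> {ae Q, forall x, (0 < q x)%R}.
Proof.
case=> mq q0 Qq; exists [set x | q x = 0%R].
have mZ : measurable [set x | q x = 0%R].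
  by rewrite -[X in measurable X]setTI; exact: (mq measurableT [set 0%R]).
split => //.
- rewrite Qq//; apply: integral0_eq => x; rewrite /= => ->//.
- by move=> x /= /negP; rewrite -leNgt => qx; apply/eqP; rewrite eq_le qx q0.
Qed.

(** [KL] integrates [lne], with [lne 0 = -oo], whereas [ln 0 = 0]: the two differ
    where the density vanishes, which is a [Q]-null set. *)
Lemma KL_density Q : Q `<< m ->
  exists2 f, is_density m Q f & KL Q m = \int[Q]_x (ln (f x))%:E.
Proof.
move=> Qm; pose F := Radon_Nikodym_SigmaFinite.f Q m.
have FE x : F x = (fine (F x))%:E.
  by rewrite fineK//; exact: Radon_Nikodym_SigmaFinite.f_fin_num.
have mF : measurable_fun setT F.
  exact: measurable_int (Radon_Nikodym_SigmaFinite.f_integrable Qm).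
have mf : measurable_fun setT (fine \o F) by exact: measurableT_comp.
have df : is_density m Q (fine \o F).
  split=> //.
  - by move=> x; rewrite fine_ge0//; exact: Radon_Nikodym_SigmaFinite.f_ge0.
  - move=> A mA; rewrite (Radon_Nikodym_SigmaFinite.f_integral Qm mA).
    by apply: eq_integral => x _; exact: FE.
exists (fine \o F) => //; rewrite /KL asboolT//.
apply: ae_eq_integral => //.
- rewrite (_ : (fun x => _) = fun x =>
      if (fine (F x) <= 0)%R then -oo else (ln (fine (F x)))%:E); last first.
    by apply/funext => x; rewrite -/F FE.
  apply: measurable_fun_ifT => //; first exact: measurable_fun_ler.
  exact/measurable_EFinP/measurable_fun_ln.
- exact/measurable_EFinP/measurable_fun_ln.
move: (density_gt0_ae df); apply: filterS => x /= fx _.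
by rewrite -/(F x) FE lne_EFin.
Qed.

(** Gibbs' inequality, from [ln u <= u - 1] at [u = r / q]. The majorant
    [w = r / q - 1] is kept in the conclusion because it is also what makes
    entropies integrable from one side. *)
Lemma gibbs Q q r : is_density m Q q -> measurable_fun setT r ->
  (forall x, 0 <= r x)%R -> \int[m]_x (r x)%:E <= 1 ->
  {ae Q, forall x, (0 < r x)%R} ->
  exists w, [/\ has_expect Q w, (expect Q w <= 0)%R &
    {ae Q, forall x, (ln (r x) - ln (q x) <= w x)%R}].
Proof.
move=> dq mr r0 r1 rpos; have [mq q0 _] := dq.
(* [expR (- ln q)] is [q^-1] where [q > 0], and is visibly measurable. *)
pose w x := (r x * expR (- ln (q x)))%R.
have mw : measurable_fun setT w.
  apply: measurable_funM => //; apply: measurableT_comp => //.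
  by apply: measurableT_comp => //; exact: measurable_fun_ln.
have w0 x : (0 <= w x)%R by rewrite mulr_ge0// expR_ge0.
have wE x : (0 < q x)%R -> (w x = r x / q x)%R.
  by move=> qx; rewrite /w expRN lnK.
have w1 : \int[Q]_x (w x)%:E <= 1.
  rewrite (density_integral (G := fun x => (w x)%:E) dq)//; last first.
    exact/measurable_EFinP.
  apply: le_trans r1; apply: ge0_le_integral => //.
  - by move=> x _ /=; rewrite -EFinM lee_fin mulr_ge0.
  - by apply: emeasurable_funM; exact/measurable_EFinP.
  - exact/measurable_EFinP.
  - move=> x _; rewrite /= -EFinM lee_fin /w.
    have [qx|qx] := ltP 0%R (q x); first by rewrite -/(w x) wE// divfK// gt_eqF.
    by rewrite (@le_anti _ _ (q x) 0%R) ?qx ?q0// mulr0.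
have sw : has_expect Q w.
  by apply: ge0_has_expect => //; exact: le_lt_trans w1 (ltry _).
exists (w \- (fun=> 1))%R; split.
- by apply: has_expectB => //; exact: has_expect_cst.
- rewrite expectB ?expect_cst//; last exact: has_expect_cst.
  by rewrite subr_le0; exact: expect_le_ge0.
- move: rpos (density_gt0_ae dq); apply: filterS2 => x rx qx.
  rewrite -ln_div ?posrE// -wE//=.
  have wx : (0 < w x)%R by rewrite wE// divr_gt0.
  rewrite -[X in ln X](subrK 1%R) addrC le_ln1Dx//; lra.
Qed.

Lemma gibbs_le Q q r : is_density m Q q -> measurable_fun setT r ->
  (forall x, 0 <= r x)%R -> \int[m]_x (r x)%:E <= 1 ->
  {ae Q, forall x, (0 < r x)%R} ->
  has_expect Q (fun x => ln (r x) - ln (q x))%R ->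
  (expect Q (fun x => ln (r x) - ln (q x))%R <= 0)%R.
Proof.
move=> dq mr r0 r1 rpos s; have [w [sw w0 rqw]] := gibbs dq mr r0 r1 rpos.
exact: le_trans (le_expect s sw rqw) w0.
Qed.

End sigma_finite_reference.

Lemma KL_probability_ge0 Q Q' : 0 <= KL Q Q'.
Proof.
have [QQ'|nQQ'] := pselect (Q `<< Q'); last by rewrite /KL asboolF// leey.
have [f df ->] := KL_density QQ'.
have mf := density_measurable df.
have [||||w [sw w0 fw]] := @gibbs Q' Q f (fun=> 1%R) df _ _ _ _ => //.
- by rewrite integral_cst// mul1e [X in X <= _](@probability_setT _ _ _ Q').
- exact: aeW.
have [foo|] := ltP (\int[Q]_x (ln (f x))%:E) +oo; last first.
  by rewrite leye_eq => /eqP ->; rewrite leey.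
have fw' : {ae Q, forall x, (- w x <= ln (f x))%R}.
  by move: fw; apply: filterS => x; rewrite ln1; lra.
have sf := has_expect_lty (measurable_fun_ln mf) (has_expectN sw) fw' foo.
rewrite -expectE// lee_fin; have := le_expect (has_expectN sw) sf fw'.
apply: le_trans; rewrite (_ : (fun x => - w x)%R = (fun x => -1 * w x)%R).
  by rewrite expectZ//; lra.
by apply/funext => x; rewrite mulN1r.
Qed.

End density.

(** * Midpoints and a Pinsker-type inequality *)

Section midpoint.
Import Order.TTheory GRing.Theory Num.Theory.
Local Open Scope classical_set_scope.
Local Open Scope ring_scope.
Local Open Scope ereal_scope.
Context d (T : measurableType d) (R : realType).
Implicit Types (Q M : probability T R) (p q f : T -> R).

Lemma eq_le1 (x : \bar R) : x = 1 -> x <= 1.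
Proof. by move=> ->. Qed.

Lemma expect_indic Q A : measurable A ->
  has_expect Q \1_A /\ (expect Q \1_A)%:E = Q A.
Proof.
move=> mA; have sA : has_expect Q \1_A.
  by apply: integrable_indic => //; rewrite ltey_eq fin_num_measure.
by split=> //; rewrite expectE// integral_indic// setIT.
Qed.

Section mixture.
Variables (M Q Q' : probability T R).
Hypothesis ME : forall G : T -> \bar R, measurable_fun setT G ->
  (forall x, 0 <= G x) ->
  \int[M]_x G x = 2^-1%:E * (\int[Q]_x G x + \int[Q']_x G x).

Lemma has_expect_mixture f : has_expect Q f -> has_expect Q' f ->
  has_expect M f.
Proof.
move=> /integrableP[mf foo] /integrableP[_ foo']; apply/integrableP; split => //.
rewrite (ME (G := fun x => `|(EFin \o f) x|))//; last exact: measurableT_comp.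
by rewrite lte_mul_pinfty// lte_add_pinfty.
Qed.

Lemma expect_mixture f : has_expect Q f -> has_expect Q' f ->
  expect M f = ((expect Q f + expect Q' f) / 2)%R.
Proof.
move=> s s'; have sM := has_expect_mixture s s'.
have mf : measurable_fun setT (EFin \o f) by case/integrableP: s.
have fpm Q0 : has_expect Q0 f -> expect Q0 f =
    (fine (\int[Q0]_x (EFin \o f)^\+ x) - fine (\int[Q0]_x (EFin \o f)^\- x))%R /\
    (\int[Q0]_x (EFin \o f)^\+ x \is a fin_num) /\
    (\int[Q0]_x (EFin \o f)^\- x \is a fin_num).
  move=> s0; have p := integrable_pos_fin_num measurableT s0.
  have n := integrable_neg_fin_num measurableT s0.
  by split=> //; rewrite /expect integralE fineB.
have [-> _] := fpm _ sM; have [-> [pQ nQ]] := fpm _ s.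
have [-> [pQ' nQ']] := fpm _ s'.
rewrite !ME//; [|exact: measurable_funeneg|exact: measurable_funepos].
have half (a b : \bar R) : a \is a fin_num -> b \is a fin_num ->
    fine (2^-1%:E * (a + b)) = ((fine a + fine b) / 2)%R.
  by case: a => // a; case: b => // b _ _ /=; rewrite mulrC.
by rewrite (half _ _ pQ pQ') (half _ _ nQ nQ'); lra.
Qed.

End mixture.


Lemma expR_le_quadratic (s : R) :
  (`|s| <= 2^-1 -> expR s <= 1 + s + 2 * s ^+ 2)%R.
Proof.
rewrite ler_norml => /andP[s1 s2].
have h : (expR s * (1 - s) <= 1)%R.
  rewrite -[leRHS](expRxMexpNx_1 s) ler_wpM2l ?expR_ge0//.
  exact: expR_ge1Dx.
have e0 := expR_ge0 s; nra.
Qed.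

Let expR_indic (s : R) (A : set T) x :
  (expR (s * \1_A x) = 1 + (expR s - 1) * \1_A x)%R.
Proof.
by rewrite indicE; case: (x \in A); rewrite /= ?mulr1 ?mulr0 ?expR0; ring.
Qed.

Let normalization_gt0 (a e : R) : (0 <= a <= 1 -> 0 < e -> 0 < 1 + (e - 1) * a)%R.
Proof. by move=> /andP[a0 a1] e0; nra. Qed.

Let tilt_arith (a b e g s l : R) : (0 <= b <= 1)%R ->
  (e <= 1 + s + 2 * s ^+ 2)%R -> (l <= 1 + (e - 1) * b - 1)%R ->
  (g + (s * a - l) <= 0)%R -> (s * (a - b) <= 2 * s ^+ 2 - g)%R.
Proof.
move=> /andP[b0 b1] es le gl.
have : ((e - 1) * b <= s * b + 2 * s ^+ 2)%R by have := sqr_ge0 s; nra.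
lra.
Qed.

Let ln_le_sub1 (x : R) : (0 < x -> ln x <= x - 1)%R.
Proof.
by move=> x0; rewrite -[X in ln X](subrK 1%R) addrC le_ln1Dx//; lra.
Qed.

(** A weak form of Pinsker's inequality,
    [KL Q M >= s * (Q A - M A) - 2 * s ^+ 2] for small [s]: it is Gibbs'
    inequality against [M] tilted by [expR (s * \1_A)] and renormalized. *)
Lemma entropy_ge_event (m : {sigma_finite_measure set T -> \bar R}) Q M q p A
    (s : R) :
  is_density m Q q -> is_density m M p -> {ae Q, forall x, (0 < p x)%R} ->
  has_expect Q (fun x => ln (p x) - ln (q x))%R -> measurable A ->
  (`|s| <= 2^-1)%R ->
  (s * (expect Q \1_A - expect M \1_A) <=
   2 * s ^+ 2 - expect Q (fun x => ln (p x) - ln (q x)))%R.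
Proof.
move=> dq dp ppos gap mA s2; have [[mp p0 _] [mq q0 _]] := (dp, dq).
have [sAQ EAQ] := expect_indic Q mA; have [sAM EAM] := expect_indic M mA.
have MA01 : (0 <= expect M \1_A <= 1)%R.
  by rewrite -!lee_fin EAM probability_le1// measure_ge0.
pose Z := (1 + (expR s - 1) * expect M \1_A)%R.
have Z0 : (0 < Z)%R by rewrite normalization_gt0// expR_gt0.
have Zinv0 : (0 <= Z^-1)%R by rewrite invr_ge0 ltW.
pose tilt x := expR (s * \1_A x).
have tilt_gt0 x : (0 < tilt x)%R by exact: expR_gt0.
have mtilt : measurable_fun setT tilt.
  by apply: measurableT_comp => //; exact: measurable_funM.
have s1 := has_expectD (has_expect_cst M 1%R) (has_expectZ (expR s - 1) sAM).
have stilt : has_expect M tilt.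
  by apply: (has_expect_ae _ s1) => //; apply: aeW => x; rewrite /tilt expR_indic.
have Etilt : expect M tilt = Z.
  rewrite /Z -[X in (X + _)%R](expect_cst M) -expectZ// -expectD//.
  - by congr expect; apply/funext => x; rewrite /tilt expR_indic.
  - exact: has_expect_cst.
  - exact: has_expectZ.
pose rho x := (Z^-1 * tilt x * p x)%R.
have mrho : measurable_fun setT rho.
  by apply: measurable_funM => //; exact: measurable_funM.
have rho0 x : (0 <= rho x)%R by rewrite mulr_ge0// mulr_ge0// ltW.
have rho1 : \int[m]_x (rho x)%:E = 1.
  under eq_integral do rewrite EFinM.
  rewrite -(density_integral (G := fun x => (Z^-1 * tilt x)%:E) dp); last 2 first.
  - by apply/measurable_EFinP; exact: measurable_funM.
  - by move=> x; rewrite lee_fin mulr_ge0// ltW.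
  rewrite -expectE; last exact: has_expectZ.
  by rewrite expectZ// Etilt mulVf// gt_eqF.
have rhopos : {ae Q, forall x, (0 < rho x)%R}.
  by move: ppos; apply: filterS => x px; rewrite mulr_gt0// mulr_gt0// invr_gt0.
have sstilt : has_expect Q (fun x => s * \1_A x - ln Z)%R.
  by apply: has_expectB; [exact: has_expectZ|exact: has_expect_cst].
have lrho : {ae Q, forall x, ((ln (p x) - ln (q x)) + (s * \1_A x - ln Z) =
    ln (rho x) - ln (q x))%R}.
  move: ppos; apply: filterS => x px.
  suff -> : rho x = expR (ln (p x) + (s * \1_A x - ln Z)) by rewrite expRK; ring.
  by rewrite !expRD expRN !lnK ?posrE// /rho /tilt; ring.
have mlr : measurable_fun setT (fun x => ln (rho x) - ln (q x))%R.
  by apply: measurable_funB => //; exact: measurable_fun_ln.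
have srho : has_expect Q (fun x => ln (rho x) - ln (q x))%R.
  exact: (has_expect_ae mlr (has_expectD gap sstilt) lrho).
have := gibbs_le dq mrho rho0 (eq_le1 rho1) rhopos srho.
rewrite -(expect_ae (has_expect_measurable (has_expectD gap sstilt)) mlr lrho).
rewrite (expectD gap sstilt) (expectB (has_expectZ s sAQ) (has_expect_cst Q _)).
rewrite (expectZ s sAQ) expect_cst.
exact: (tilt_arith MA01 (expR_le_quadratic s2) (ln_le_sub1 Z0)).
Qed.

Lemma exists_midpoint (m : {sigma_finite_measure set T -> \bar R}) Q Q' q q' :
  is_density m Q q -> is_density m Q' q' ->
  exists2 M, is_density m M (fun x => (q x + q' x) / 2)%R &
    forall G : T -> \bar R, measurable_fun setT G -> (forall x, 0 <= G x) ->
    \int[M]_x G x = 2^-1%:E * (\int[Q]_x G x + \int[Q']_x G x).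
Proof.
move=> dq dq'; have [[mq q0 _] [mq' q0' _]] := (dq, dq').
pose p x := ((q x + q' x) / 2)%R.
have mp : measurable_fun setT p.
  by apply: measurable_funM => //; exact: measurable_funD.
have p0 x : (0 <= p x)%R by rewrite divr_ge0// addr_ge0.
have pE (G : T -> \bar R) : measurable_fun setT G -> (forall x, 0 <= G x) ->
    \int[m]_x (G x * (p x)%:E) = 2^-1%:E * (\int[Q]_x G x + \int[Q']_x G x).
  move=> mG G0; rewrite (density_integral dq mG G0) (density_integral dq' mG G0).
  have mGq : measurable_fun setT (fun x => G x * (q x)%:E).
    by apply: emeasurable_funM => //; exact/measurable_EFinP.
  have mGq' : measurable_fun setT (fun x => G x * (q' x)%:E).
    by apply: emeasurable_funM => //; exact/measurable_EFinP.
  rewrite -ge0_integralD//; [|by move=> x _; rewrite mule_ge0// lee_fin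
    |by move=> x _; rewrite mule_ge0// lee_fin].
  rewrite -ge0_integralZl//; [|exact: emeasurable_funD
    |by move=> x _; rewrite adde_ge0// mule_ge0// lee_fin].
  apply: eq_integral => x _; rewrite -ge0_muleDr ?lee_fin// muleCA.
  by rewrite -EFinD -EFinM mulrC.
have p1 : \int[m]_x (p x)%:E = 1.
  transitivity (\int[m]_x (1 * (p x)%:E)).
    by apply: eq_integral => x _; rewrite mul1e.
  rewrite (pE (cst 1))// !integral_cst// !mul1e.
  rewrite [X in X + _](@probability_setT _ _ _ Q).
  rewrite [X in _ + X](@probability_setT _ _ _ Q') -EFinD -EFinM.
  by congr EFin; lra.
have [M dM] := exists_density mp p0 p1.
by exists M => // G mG G0; rewrite (density_integral dM mG G0) pE.
Qed.

(** The density of a midpoint is at least half of that of an endpoint. *)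
Lemma has_expect_midpoint (m : {sigma_finite_measure set T -> \bar R}) Q M q p :
  is_density m Q q -> is_density m M p ->
  (forall x, q x / 2 <= p x)%R ->
  {ae Q, forall x, (0 < p x)%R} /\ has_expect Q (fun x => ln (p x) - ln (q x))%R.
Proof.
move=> dq dp qp; have [[mp p0 _] [mq q0 _]] := (dp, dq).
have posQ := density_gt0_ae dq.
have pposQ : {ae Q, forall x, (0 < p x)%R}.
  by move: posQ; apply: filterS => x qx; rewrite (lt_le_trans _ (qp x))// divr_gt0.
have [w [sw _ ub]] := gibbs dq mp p0 (eq_le1 (density_integral1 dp)) pposQ.
split=> //; apply: (has_expect_between _ (has_expect_cst Q (- ln 2)%R) sw).
  by apply: measurable_funB; exact: measurable_fun_ln.
move: posQ pposQ ub; apply: filterS3 => x qx px ->; rewrite andbT.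
rewrite -ln_div ?posrE// -lnV ?posrE// ler_ln ?posrE ?invr_gt0 ?divr_gt0//.
by rewrite ler_pdivlMr// mulrC qp.
Qed.

End midpoint.

(** * Products of measures *)

Section products.
Import Order.TTheory GRing.Theory Num.Theory.
Local Open Scope classical_set_scope.
Local Open Scope ring_scope.
Local Open Scope ereal_scope.
Context d1 d2 (T1 : measurableType d1) (T2 : measurableType d2) (R : realType).

Definition pprod (mu : probability T1 R) (nu : probability T2 R) :
  probability (T1 * T2)%type R := (mu \x nu).

Section sigma_finite_product.
Variables (m1 : {sigma_finite_measure set T1 -> \bar R})
  (m2 : {sigma_finite_measure set T2 -> \bar R}).

Lemma sigma_finite_product : sigma_finite setT (m1 \x m2).
Proof.
have /sigma_finiteP[A [A1 ndA Aoo]] := sigma_finiteT m1.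
have /sigma_finiteP[B [B1 ndB Boo]] := sigma_finiteT m2.
exists (fun n => A n `*` B n) => [|n].
  apply/seteqP; split => // -[x y] _.
  have [k _ Akx] : (\bigcup_k A k) x by rewrite -A1.
  have [l _ Bly] : (\bigcup_k B k) y by rewrite -B1.
  exists (maxn k l) => //; split => /=.
  - by move: x Akx; exact/subsetPset/ndA/leq_maxl.
  - by move: y Bly; exact/subsetPset/ndB/leq_maxr.
have [[mA Ay] [mB By]] := (Aoo n, Boo n).
split; first exact: measurableX.
by rewrite product_measure1E// lte_mul_pinfty// ge0_fin_numE.
Qed.

(** Radon-Nikodym derivatives with respect to a product are only available when
    the product carries its sigma-finite structure. *)
Definition sfprod : {sigma_finite_measure set (T1 * T2)%type -> \bar R} :=
  HB.pack (m1 \x m2)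
    (Measure_isSigmaFinite.Build _ _ _ (m1 \x m2) sigma_finite_product).

Lemma sfprod_tonelli1 (f : T1 * T2 -> \bar R) : measurable_fun setT f ->
  (forall w, 0 <= f w) ->
  \int[sfprod]_w f w = \int[m1]_x \int[m2]_y f (x, y).
Proof. exact: fubini_tonelli1. Qed.

Lemma sfprod_tonelli2 (f : T1 * T2 -> \bar R) : measurable_fun setT f ->
  (forall w, 0 <= f w) ->
  \int[sfprod]_w f w = \int[m2]_y \int[m1]_x f (x, y).
Proof. exact: fubini_tonelli2. Qed.

End sigma_finite_product.

Lemma pprod_tonelli1 (mu : probability T1 R) (nu : probability T2 R)
    (f : T1 * T2 -> \bar R) : measurable_fun setT f -> (forall w, 0 <= f w) ->
  \int[pprod mu nu]_w f w = \int[mu]_x \int[nu]_y f (x, y).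
Proof. exact: fubini_tonelli1. Qed.

Lemma pprod_tonelli2 (mu : probability T1 R) (nu : probability T2 R)
    (f : T1 * T2 -> \bar R) : measurable_fun setT f -> (forall w, 0 <= f w) ->
  \int[pprod mu nu]_w f w = \int[nu]_y \int[mu]_x f (x, y).
Proof. exact: fubini_tonelli2. Qed.

End products.

Section gluing_integrals.
Import Order.TTheory GRing.Theory Num.Theory.
Local Open Scope classical_set_scope.
Local Open Scope ring_scope.
Local Open Scope ereal_scope.
Context d1 d2 d3 (T1 : measurableType d1) (T2 : measurableType d2)
  (T3 : measurableType d3) (R : realType).

Lemma ge0_integral_conditional_product
    (mu : probability T1 R) (nu : probability T2 R)
    (lam : {sigma_finite_measure set T3 -> \bar R})
    (a : T1 * T3 -> \bar R) (b : T2 * T3 -> \bar R) (c : T3 -> \bar R) :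
  measurable_fun setT a -> measurable_fun setT b -> measurable_fun setT c ->
  (forall x, 0 <= a x) -> (forall x, 0 <= b x) -> (forall x, 0 <= c x) ->
  \int[sfprod (pprod mu nu) lam]_w
    (a (w.1.1, w.2) * b (w.1.2, w.2) * c w.2) =
  \int[lam]_z ((\int[mu]_x a (x, z)) * (\int[nu]_y b (y, z)) * c z).
Proof.
move=> ma mb mc a0 b0 c0.
have mF : measurable_fun setT (fun w : T1 * T2 * T3 =>
    a (w.1.1, w.2) * b (w.1.2, w.2) * c w.2).
  apply: emeasurable_funM; last exact: measurableT_comp.
  apply: emeasurable_funM; apply: measurableT_comp => //;
    apply/measurable_fun_pair => //=; exact: measurableT_comp.
rewrite (sfprod_tonelli2 (pprod mu nu) lam (f := fun w =>
  a (w.1.1, w.2) * b (w.1.2, w.2) * c w.2))//; last first.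
  by move=> w; rewrite !mule_ge0.
apply: eq_integral => z _ /=.
have maz : measurable_fun setT (fun x => a (x, z)) by exact: measurableT_comp.
have mbz : measurable_fun setT (fun y => b (y, z)) by exact: measurableT_comp.
rewrite (pprod_tonelli1 mu nu
  (f := fun v => a (v.1, z) * b (v.2, z) * c z))//; last 2 first.
- by apply: emeasurable_funM => //; apply: emeasurable_funM;
    [exact: (measurableT_comp maz)|exact: (measurableT_comp mbz)].
- by move=> v; rewrite !mule_ge0.
rewrite /= -muleA -ge0_integralZr//; last first.
  by rewrite mule_ge0// integral_ge0.
apply: eq_integral => x _.
rewrite ge0_integralZr//; last 2 first.
- exact: measurable_funeM.
- by move=> y _; rewrite mule_ge0.
by rewrite ge0_integralZl// muleA.
Qed.

Section gluing.
Variables (mu : probability T1 R) (nu : probability T2 R)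
  (eta : probability T3 R) (lam : {sigma_finite_measure set T3 -> \bar R}).
Variables (P : probability (T1 * T3)%type R) (f : T1 * T3 -> R).
Hypotheses (etaP : has_law P snd eta) (Pf : is_density (pprod mu eta) P f).

Lemma ge0_integral_density_section (G : T1 * T3 -> \bar R) :
  measurable_fun setT G -> (forall w, 0 <= G w) ->
  \int[eta]_z (\int[mu]_x (G (x, z) * (f (x, z))%:E)) = \int[P]_w G w.
Proof.
move=> mG G0; have [mf f0 _] := Pf.
rewrite (density_integral Pf mG G0).
rewrite (pprod_tonelli2 mu eta (f := fun w => G w * (f w)%:E))//.
- by apply: emeasurable_funM => //; exact/measurable_EFinP.
- by move=> w; rewrite mule_ge0// lee_fin.
Qed.

(** The sections of the density of a coupling integrate to one, in the weak
    form that gluing needs. *)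
Lemma ge0_integral_density_section1 (Phi : T3 -> \bar R) :
  measurable_fun setT Phi -> (forall z, 0 <= Phi z) ->
  \int[eta]_z (Phi z * \int[mu]_x (f (x, z))%:E) = \int[eta]_z Phi z.
Proof.
move=> mPhi Phi0; have [mf f0 _] := Pf.
transitivity (\int[eta]_z \int[mu]_x ((Phi \o snd) (x, z) * (f (x, z))%:E)).
  apply: eq_integral => z _; rewrite /= ge0_integralZl//.
  - by apply/measurable_EFinP; exact: measurableT_comp.
  - by move=> x _; rewrite lee_fin.
rewrite (@ge0_integral_density_section (Phi \o snd)); last 2 first.
- exact: measurableT_comp.
- by move=> w; exact: Phi0.
by rewrite -(ge0_integral_law _ etaP).
Qed.

End gluing.

End gluing_integrals.

(** * Relative entropy and entropic transport cost *)

Section ereal_facts.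
Import Order.TTheory GRing.Theory Num.Theory.
Local Open Scope ring_scope.
Local Open Scope ereal_scope.
Context (R : realType).

Lemma dadde_EFin_le (x : \bar R) (a b : R) : x <= a%:E ->
  (x + b%:E)%dE <= (a + b)%:E.
Proof.
case: x => [x|//|_]; last exact: leNye.
rewrite lee_fin => xa; change ((x + b)%:E <= (a + b)%:E).
by rewrite lee_fin lerD2r. Qed.

Lemma dadde3_lty (e : R) (x y k : \bar R) : (0 < e)%R -> 0 <= x -> 0 <= y ->
  ((x + y)%E + (e%:E * k)%E)%dE < +oo -> [/\ x < +oo, y < +oo & k < +oo].
Proof.
move=> e0; case: x => [x| |]//= _; case: y => [y| |]//= _; rewrite ?ltry//.
by case: k => [k| |]//=; rewrite ?ltry ?ltNyr// mulry gtr0_sg// mul1e.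
Qed.

Lemma trap_summand (l a b q v : R) :
  (l <= a -> a + b - q <= v -> l <= a <= q - b + v)%R.
Proof. by move=> la h; rewrite la /=; lra. Qed.

End ereal_facts.

Section KL_facts.
Import Order.TTheory GRing.Theory Num.Theory.
Local Open Scope classical_set_scope.
Local Open Scope ring_scope.
Local Open Scope ereal_scope.
Context d (T : measurableType d) (R : realType).

Lemma KL_fin_density (Q : probability T R)
    (m : {sigma_finite_measure set T -> \bar R}) f :
  is_density m Q f -> KL Q m = \int[Q]_x (ln (f x))%:E ->
  has_expect Q (fun x => ln (f x)) ->
  KL Q m = (expect Q (fun x => ln (f x)))%:E.
Proof. by move=> df -> lf; rewrite expectE. Qed.

(** Gibbs' inequality against the constant density one, which has total mass one
    because the reference measure is a probability. *)
Lemma probability_density_lb (Q Q' : probability T R) f :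
  is_density Q' Q f -> exists w, [/\ has_expect Q w, (expect Q w <= 0)%R &
    {ae Q, forall x, (- w x <= ln (f x))%R}].
Proof.
move=> df; have [||||w [sw w0 fw]] := @gibbs _ _ _ Q' Q f (fun=> 1%R) df _ _ _ _ => //.
- by rewrite integral_cst// mul1e [X in X <= _](@probability_setT _ _ _ Q').
- exact: aeW.
exists w; split => //; move: fw; apply: filterS => x; rewrite ln1; lra.
Qed.

Lemma density_self (Q : probability T R) : is_density Q Q (fun=> 1%R).
Proof. by split=> // A mA; rewrite (integral_cst Q mA 1) mul1e. Qed.

(** [ln f <= f - 1], and [f] has mean one under [Q] itself; this makes the
    entropic cost finite through the product coupling. *)
Lemma KL_self (Q : probability T R) : KL Q Q <= 0.
Proof.
have QQ : Q `<< Q by [].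
have [f df ->] := KL_density QQ; have [mf f0 _] := df.
have [w [sw _ wf]] := probability_density_lb df.
have sf : has_expect Q f.
  by apply: ge0_has_expect => //; rewrite (density_integral1 df) ltry.
have fub : {ae Q, forall x, (ln (f x) <= f x - 1)%R}.
  move: (density_gt0_ae df); apply: filterS => x fx.
  by rewrite -[X in ln X](subrK 1%R) addrC le_ln1Dx//; lra.
have sf1 : has_expect Q (fun x => f x - 1)%R.
  by apply: (has_expectB sf); exact: has_expect_cst.
have slf : has_expect Q (fun x => ln (f x)).
  apply: (has_expect_between _ (has_expectN sw) sf1).
    exact: measurable_fun_ln.
  by move: wf fub; apply: filterS2 => x -> ->.
rewrite -expectE// lee_fin (le_trans (le_expect slf sf1 fub))//.
rewrite (expectB sf (has_expect_cst _ _)) expect_cst.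
by rewrite /expect (density_integral1 df) /= subrr.
Qed.

End KL_facts.

Lemma law_coupling d d1 d2 (T : measurableType d) (T1 : measurableType d1)
    (T2 : measurableType d2) (R : realType) (Q : probability T R)
    (phi : T -> T1 * T2) (mu : probability T1 R) (eta : probability T2 R)
    (P : probability (T1 * T2)%type R) :
  has_law Q (fst \o phi) mu -> has_law Q (snd \o phi) eta ->
  has_law Q phi P -> is_coupling mu eta P.
Proof.
move=> l1 l2 lP; split=> A mA; rewrite /pushforward.
  by rewrite -l1// -lP// -[X in measurable X]setTI; exact: measurable_fst.
by rewrite -l2// -lP// -[X in measurable X]setTI; exact: measurable_snd.
Qed.

Section eot_facts.
Import Order.TTheory GRing.Theory Num.Theory.
Local Open Scope classical_set_scope.
Local Open Scope ring_scope.
Local Open Scope ereal_scope.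
Context d1 d2 (T1 : measurableType d1) (T2 : measurableType d2) (R : realType).
Variables (eps : R) (b : T1 -> T2 -> R).
Hypotheses (eps_gt0 : (0 < eps)%R) (b_ge0 : forall x y, (0 <= b x y)%R).
Hypothesis mb : measurable_fun setT (fun w : T1 * T2 => b w.1 w.2).
Variables (mu : probability T1 R) (eta : probability T2 R).
Implicit Type P : probability (T1 * T2)%type R.

Lemma eot_costE P f : is_density (pprod mu eta) P f ->
  KL P (pprod mu eta) = \int[P]_w (ln (f w))%:E ->
  has_expect P (fun w => b w.1 w.2) -> has_expect P (fun w => ln (f w)) ->
  eot_cost eps b mu eta P =
  (expect P (fun w => b w.1 w.2) + eps * expect P (fun w => ln (f w)))%:E.
Proof.
move=> df KLE sb sf; rewrite /eot_cost -/(pprod mu eta) (KL_fin_density df)//.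
by rewrite -expectE.
Qed.

Lemma eot_cost_ge0 P : 0 <= eot_cost eps b mu eta P.
Proof.
rewrite adde_ge0//; first by apply: integral_ge0 => w _; rewrite lee_fin.
apply: mule_ge0; first by rewrite lee_fin ltW.
exact: (KL_probability_ge0 P (pprod mu eta)).
Qed.

Lemma EOT_ge0 : 0 <= EOT eps b mu eta.
Proof. by apply/ereal_infP => _ [P _ <-]; exact: eot_cost_ge0. Qed.

Lemma EOT_le P : is_coupling mu eta P -> EOT eps b mu eta <= eot_cost eps b mu eta P.
Proof. by move=> cP; apply: ereal_inf_lbound; exists P. Qed.

Lemma EOT_adherent (delta : R) : (0 < delta)%R -> EOT eps b mu eta < +oo ->
  exists2 P, is_coupling mu eta P &
    eot_cost eps b mu eta P <= EOT eps b mu eta + delta%:E.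
Proof.
move=> delta0 foo.
have fin : EOT eps b mu eta \is a fin_num by rewrite ge0_fin_numE// EOT_ge0.
have [_ [P cP <-] /ltW h] := lb_ereal_inf_adherent delta0 fin.
by exists P.
Qed.

(** Both terms of the cost are nonnegative, so both are finite together. *)
Lemma eot_cost_fin P : eot_cost eps b mu eta P < +oo ->
  exists f, [/\ is_density (pprod mu eta) P f,
    has_expect P (fun w => b w.1 w.2), has_expect P (fun w => ln (f w)) &
    eot_cost eps b mu eta P =
    (expect P (fun w => b w.1 w.2) + eps * expect P (fun w => ln (f w)))%:E].
Proof.
move=> foo.
have b0 : 0 <= \int[P]_w (b w.1 w.2)%:E.
  by apply: integral_ge0 => w _; rewrite lee_fin.
have K0 : 0 <= KL P (pprod mu eta) by exact: KL_probability_ge0.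
have eK0 : 0 <= eps%:E * KL P (pprod mu eta).
  by rewrite mule_ge0// lee_fin ltW.
have boo : \int[P]_w (b w.1 w.2)%:E < +oo.
  by apply: le_lt_trans foo; rewrite /eot_cost leeDl.
have Koo : KL P (pprod mu eta) < +oo.
  rewrite ltey; apply: contraTneq foo => KE.
  rewrite /eot_cost -/(pprod mu eta) KE mulry gtr0_sg// mul1e addey ?ltxx//.
  by rewrite gt_eqF// (lt_le_trans _ b0).
have Pm : P `<< pprod mu eta.
  by apply: contrapT => nPm; move: Koo; rewrite /KL asboolF.
have [f df KE] := KL_density Pm.
have [w [sw _ wf]] := probability_density_lb df.
have sf : has_expect P (fun w => ln (f w)).
  apply: (has_expect_lty _ (has_expectN sw) wf); last by rewrite -KE.
  by apply: measurable_fun_ln; case: df.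
have sb : has_expect P (fun w => b w.1 w.2) by exact: ge0_has_expect.
by exists f; split => //; exact: eot_costE.
Qed.

Lemma pprod_coupling : is_coupling mu eta (pprod mu eta).
Proof.
split=> A mA; rewrite /pushforward /=.
  by rewrite -setXT /pprod /= product_measure1E// [X in _ * X]probability_setT mule1.
by rewrite -setTX /pprod /= product_measure1E// [X in X * _]probability_setT mul1e.
Qed.

Lemma EOT_lty : \int[pprod mu eta]_w (b w.1 w.2)%:E < +oo ->
  EOT eps b mu eta < +oo.
Proof.
move=> boo; apply: le_lt_trans (EOT_le pprod_coupling) _.
rewrite /eot_cost lte_add_pinfty//.
apply: (@le_lt_trans _ _ 0); last by rewrite ltry.
rewrite -[leRHS](mule0 eps%:E); apply: lee_wpmul2l.
  by rewrite lee_fin ltW.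
exact: (KL_self (pprod mu eta)).
Qed.

End eot_facts.

(** * Gluing two couplings along a common marginal *)

Section gluing_plans.
Import Order.TTheory GRing.Theory Num.Theory.
Local Open Scope classical_set_scope.
Local Open Scope ring_scope.
Local Open Scope ereal_scope.
Context d1 d2 d3 (T1 : measurableType d1) (T2 : measurableType d2)
  (T3 : measurableType d3) (R : realType).
Variables (mu : probability T1 R) (nu : probability T2 R)
  (lam : {sigma_finite_measure set T3 -> \bar R}).
Local Notation m3 := (sfprod (pprod mu nu) lam).
Local Notation T := (T1 * T2 * T3)%type.

Definition toxz (w : T) : T1 * T3 := (w.1.1, w.2).
Definition toyz (w : T) : T2 * T3 := (w.1.2, w.2).

Lemma measurable_toxz : measurable_fun setT toxz.
Proof. by apply/measurable_fun_pair => //=; exact: measurableT_comp. Qed.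

Lemma measurable_toyz : measurable_fun setT toyz.
Proof. by apply/measurable_fun_pair => //=; exact: measurableT_comp. Qed.

Section gluing.
Variables (eta : probability T3 R) (P1 : probability (T1 * T3)%type R)
  (P2 : probability (T2 * T3)%type R).
Variables (f1 : T1 * T3 -> R) (f2 : T2 * T3 -> R) (h : T3 -> R).
Hypotheses (df1 : is_density (pprod mu eta) P1 f1)
  (df2 : is_density (pprod nu eta) P2 f2) (dh : is_density lam eta h).
Hypotheses (P1eta : has_law P1 snd eta) (P2eta : has_law P2 snd eta).

(** Density of the plan under which the first two coordinates are
    conditionally independent given the third. *)
Definition glued (w : T) : R := (f1 (toxz w) * f2 (toyz w) * h w.2)%R.

Lemma measurable_glued : measurable_fun setT glued.
Proof.
case: df1 df2 dh => mf1 _ _ [mf2 _ _] [mh _ _].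
apply: measurable_funM; last exact: measurableT_comp.
apply: measurable_funM; apply: measurableT_comp => //.
  exact: measurable_toxz.
exact: measurable_toyz.
Qed.

Lemma glued_ge0 w : (0 <= glued w)%R.
Proof.
by case: df1 df2 dh => _ f10 _ [_ f20 _] [_ h0 _]; rewrite !mulr_ge0.
Qed.

(** Integrating out the coordinate of the other coupling leaves a factor whose
    integral is one for almost every third coordinate. *)
Lemma glued_integral1 (G : T1 * T3 -> \bar R) :
  measurable_fun setT G -> (forall v, 0 <= G v) ->
  \int[m3]_w (G (toxz w) * (glued w)%:E) = \int[P1]_v G v.
Proof.
move=> mG G0; case: (df1) (df2) (dh) => mf1 f10 _ [mf2 f20 _] [mh h0 _].
transitivity (\int[m3]_w ((fun v => G v * (f1 v)%:E) (w.1.1, w.2) *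
    (fun v => (f2 v)%:E) (w.1.2, w.2) * (fun z => (h z)%:E) w.2)).
  by apply: eq_integral => w _; rewrite /glued /= !EFinM !muleA.
have mGf : measurable_fun setT (fun v => G v * (f1 v)%:E).
  by apply: emeasurable_funM => //; exact/measurable_EFinP.
have Gf0 v : 0 <= G v * (f1 v)%:E by rewrite mule_ge0// lee_fin.
rewrite (@ge0_integral_conditional_product _ _ _ _ _ _ _ mu nu lam
  (fun v => G v * (f1 v)%:E) (fun v => (f2 v)%:E) (fun z => (h z)%:E))//;
  do ?[exact/measurable_EFinP | by move=> v; rewrite lee_fin].
have mPhi : measurable_fun setT (fun z => \int[mu]_x (G (x, z) * (f1 (x, z))%:E)).
  exact: (measurable_fun_fubini_tonelli_G (fun v => G v * (f1 v)%:E)).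
have mPsi : measurable_fun setT (fun z => \int[nu]_y (f2 (y, z))%:E).
  apply: (measurable_fun_fubini_tonelli_G (fun v => (f2 v)%:E)).
    exact/measurable_EFinP.
  by move=> v; rewrite lee_fin.
rewrite -(density_integral (G := fun z =>
  (\int[mu]_x (G (x, z) * (f1 (x, z))%:E)) * (\int[nu]_y (f2 (y, z))%:E)) dh);
  last 2 first.
- exact: emeasurable_funM.
- by move=> z; rewrite mule_ge0// integral_ge0// => y _; rewrite lee_fin.
rewrite (ge0_integral_density_section1 P2eta df2)//; last first.
  by move=> z; rewrite integral_ge0.
exact: ge0_integral_density_section.
Qed.

Lemma glued_integral2 (G : T2 * T3 -> \bar R) :
  measurable_fun setT G -> (forall v, 0 <= G v) ->
  \int[m3]_w (G (toyz w) * (glued w)%:E) = \int[P2]_v G v.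
Proof.
move=> mG G0; case: (df1) (df2) (dh) => mf1 f10 _ [mf2 f20 _] [mh h0 _].
transitivity (\int[m3]_w ((fun v => (f1 v)%:E) (w.1.1, w.2) *
    (fun v => G v * (f2 v)%:E) (w.1.2, w.2) * (fun z => (h z)%:E) w.2)).
  by apply: eq_integral => w _; rewrite /glued /= !EFinM !muleA [G _ * _]muleC.
have mGf : measurable_fun setT (fun v => G v * (f2 v)%:E).
  by apply: emeasurable_funM => //; exact/measurable_EFinP.
have Gf0 v : 0 <= G v * (f2 v)%:E by rewrite mule_ge0// lee_fin.
rewrite (@ge0_integral_conditional_product _ _ _ _ _ _ _ mu nu lam
  (fun v => (f1 v)%:E) (fun v => G v * (f2 v)%:E) (fun z => (h z)%:E))//;
  do ?[exact/measurable_EFinP | by move=> v; rewrite lee_fin].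
have mPhi : measurable_fun setT (fun z => \int[nu]_y (G (y, z) * (f2 (y, z))%:E)).
  exact: (measurable_fun_fubini_tonelli_G (fun v => G v * (f2 v)%:E)).
have mPsi : measurable_fun setT (fun z => \int[mu]_x (f1 (x, z))%:E).
  apply: (measurable_fun_fubini_tonelli_G (fun v => (f1 v)%:E)).
    exact/measurable_EFinP.
  by move=> v; rewrite lee_fin.
under eq_integral do rewrite [X in X * _]muleC.
rewrite -(density_integral (G := fun z =>
  (\int[nu]_y (G (y, z) * (f2 (y, z))%:E)) * (\int[mu]_x (f1 (x, z))%:E)) dh);
  last 2 first.
- exact: emeasurable_funM.
- by move=> z; rewrite mule_ge0// integral_ge0// => y _; rewrite lee_fin.
rewrite (ge0_integral_density_section1 P1eta df1)//; last first.
  by move=> z; rewrite integral_ge0.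
exact: ge0_integral_density_section.
Qed.

Lemma integral_glued : \int[m3]_w (glued w)%:E = 1.
Proof.
rewrite -(@probability_setT _ _ _ P1) -[P1 setT]mul1e -integral_cst//.
rewrite -(glued_integral1 (G := cst 1))//.
by apply: eq_integral => w _; rewrite mul1e.
Qed.

Lemma exists_glued : exists Q, [/\ is_density m3 Q glued,
  has_law Q toxz P1 & has_law Q toyz P2].
Proof.
have [Q dQ] := exists_density measurable_glued glued_ge0 integral_glued.
exists Q; split => //.
- apply: law_of_integral; first exact: measurable_toxz.
  move=> G mG G0; rewrite -glued_integral1// (density_integral dQ)//.
  by apply: measurableT_comp => //; exact: measurable_toxz.
- apply: law_of_integral; first exact: measurable_toyz.
  move=> G mG G0; rewrite -glued_integral2// (density_integral dQ)//.
  by apply: measurableT_comp => //; exact: measurable_toyz.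
Qed.

End gluing.

End gluing_plans.

(** * Absolute continuity of marginals *)

Section domination.
Import Order.TTheory GRing.Theory Num.Theory.
Local Open Scope classical_set_scope.
Local Open Scope ring_scope.
Local Open Scope ereal_scope.
Context d1 d3 (T1 : measurableType d1) (T3 : measurableType d3) (R : realType).
Variables (mu : probability T1 R) (lam : {sigma_finite_measure set T3 -> \bar R}).

(** The reference measure on the second factor can be replaced by the second
    marginal, whose density is positive almost everywhere. *)
Lemma dominated_by_marginal (P : probability (T1 * T3)%type R)
    (eta : probability T3 R) :
  P `<< sfprod mu lam -> has_law P snd eta -> eta `<< lam ->
  P `<< pprod mu eta.
Proof.
move=> Pm leta etalam; have [h dh _] := KL_density etalam.
apply/null_content_dominatesP => N mN N0; have [mh h0 _] := dh.
have mI : measurable_fun setT (fun v : T1 * T3 => (\1_N v)%:E : \bar R).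
  exact/measurable_EFinP/measurable_indic.
have I0 (v : T1 * T3) : 0 <= (\1_N v)%:E :> \bar R by rewrite lee_fin.
have mIh : measurable_fun setT (fun v : T1 * T3 =>
    (\1_N v)%:E * (h v.2)%:E : \bar R).
  apply: emeasurable_funM => //; apply/measurable_EFinP.
  exact: measurableT_comp.
have Ih0 (v : T1 * T3) : 0 <= (\1_N v)%:E * (h v.2)%:E :> \bar R.
  by rewrite mule_ge0// lee_fin.
have zero : \int[sfprod mu lam]_v ((\1_N v)%:E * (h v.2)%:E) = 0.
  rewrite (sfprod_tonelli2 mu lam (f := fun v => (\1_N v)%:E * (h v.2)%:E))//.
  transitivity (\int[lam]_z (\int[mu]_x (\1_N (x, z))%:E * (h z)%:E)).
    apply: eq_integral => z _; rewrite /= ge0_integralZr ?lee_fin//.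
    exact: (measurableT_comp mI).
  rewrite -(density_integral (G := fun z => \int[mu]_x (\1_N (x, z))%:E) dh);
    last 2 first.
  - exact: (measurable_fun_fubini_tonelli_G (fun v => (\1_N v)%:E)).
  - by move=> z; apply: integral_ge0.
  rewrite -(pprod_tonelli2 mu eta (f := fun v => (\1_N v)%:E))//.
  by rewrite integral_indic// setIT.
have ae0 : {ae P, forall v : T1 * T3, (\1_N v)%:E * (h v.2)%:E = 0 :> \bar R}.
  have : ae_eq (sfprod mu lam) setT
      (fun v : T1 * T3 => (\1_N v)%:E * (h v.2)%:E : \bar R) (cst 0).
    apply/ae_eq_integral_abs => //; rewrite -[RHS]zero; apply: eq_integral => v _.
    by rewrite gee0_abs.
  move/(null_dominates_ae_eq measurableT Pm).
  by apply: filterS => v; exact.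
have hpos := ae_law (@measurable_snd _ _ T1 T3) leta (density_gt0_ae dh).
have : {ae P, forall v, ~ N v}.
  move: ae0 hpos; apply: filterS2 => v e hv Nv; move: e => /eqP.
  by rewrite indicE mem_set// mul1e eqe gt_eqF.
move=> aeN; apply: measure_negligible => //.
by apply: negligibleS aeN => v Nv /=; exact.
Qed.

End domination.

(** * The three-marginal problem *)

Section three_marginals.
Import Order.TTheory GRing.Theory Num.Theory.
Local Open Scope classical_set_scope.
Local Open Scope ring_scope.
Local Open Scope ereal_scope.
Context d1 d2 d3 (T1 : measurableType d1) (T2 : measurableType d2)
  (T3 : measurableType d3) (R : realType).
Variables (mu : probability T1 R) (nu : probability T2 R)
  (lam : {sigma_finite_measure set T3 -> \bar R}).
Local Notation m3 := (sfprod (pprod mu nu) lam).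
Local Notation T := (T1 * T2 * T3)%type.
Local Notation xz := (@toxz _ _ _ T1 T2 T3).
Local Notation yz := (@toyz _ _ _ T1 T2 T3).
Local Notation measurable_xz := (@measurable_toxz _ _ _ T1 T2 T3).
Local Notation measurable_yz := (@measurable_toyz _ _ _ T1 T2 T3).
(* [c1] and [c2] are the costs of moving the endpoints to the midpoint, [c12] is
   the cost between the endpoints, and [g ((x, y), _)] is the density of the
   bridge from [x] to [y]. The bounds [alpha] and [beta] make [c12] integrable
   under every plan, and the subprobability density [r] keeps the entropy of the
   midpoint away from [-oo] when the costs are finite. *)
Variables (eps kappa D C : R) (c1 : T1 -> T3 -> R) (c2 : T2 -> T3 -> R)
  (c12 : T1 -> T2 -> R) (g : T -> R) (r : T3 -> R)
  (alpha : T1 -> R) (beta : T2 -> R).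
Hypotheses (eps_gt0 : (0 < eps)%R)
  (c1_ge0 : forall x z, (0 <= c1 x z)%R) (c2_ge0 : forall y z, (0 <= c2 y z)%R)
  (c12_ge0 : forall x y, (0 <= c12 x y)%R)
  (mc1 : measurable_fun setT (fun v : T1 * T3 => c1 v.1 v.2))
  (mc2 : measurable_fun setT (fun v : T2 * T3 => c2 v.1 v.2))
  (mc12 : measurable_fun setT (fun v : T1 * T2 => c12 v.1 v.2)).
Hypotheses (c12_le : forall x y, (c12 x y <= alpha x + beta y)%R)
  (alphaL : has_expect mu alpha) (betaL : has_expect nu beta).
Hypotheses (mg : measurable_fun setT g) (g_gt0 : forall w, (0 < g w)%R)
  (g1 : forall v, \int[lam]_z (g (v, z))%:E = 1)
  (cost_split : forall x y z,
    (c1 x z + c2 y z = c12 x y - eps * ln (g ((x, y), z)) + kappa)%R)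
  (bridge_cost : forall v,
    \int[lam]_z ((c1 v.1 z + c2 v.2 z) * g (v, z))%:E <=
    (c12 v.1 v.2 + D)%:E).
Hypotheses (mr : measurable_fun setT r) (r_gt0 : forall z, (0 < r z)%R)
  (r_le1 : \int[lam]_z (r z)%:E <= 1)
  (r_lb : forall x z, (- ln (r z) <= C * (alpha x + c1 x z + 1))%R).

Record three_plan (Q : probability T R) (q : T -> R) : Prop := ThreePlan {
  plan_density : is_density m3 Q q ;
  plan_law1 : has_law Q (fun w => w.1.1) mu ;
  plan_law2 : has_law Q (fun w => w.1.2) nu }.

(** The logarithm of the density relative to the law that draws the endpoints
    independently and the midpoint from the bridge; its expectation is the
    corresponding relative entropy. *)
Definition excess (q : T -> R) (w : T) : R := (ln (q w) - ln (g w))%R.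

Definition plan_cost (Q : probability T R) (q : T -> R) : R :=
  (expect Q (fun w => c12 w.1.1 w.1.2) + eps * expect Q (excess q))%R.

Definition interpolation (eta : probability T3 R) : \bar R :=
  ((EOT eps c1 mu eta + EOT eps c2 nu eta)%E + (eps%:E * KL eta lam)%E)%dE.

Let mlg : measurable_fun setT (fun w => ln (g w)).
Proof. exact: measurable_fun_ln. Qed.

Let measurable_p11 : measurable_fun setT (fun w : T => w.1.1).
Proof. exact: measurableT_comp. Qed.

Let measurable_p12 : measurable_fun setT (fun w : T => w.1.2).
Proof. exact: measurableT_comp. Qed.

Lemma measurable_excess q : measurable_fun setT q ->
  measurable_fun setT (excess q).
Proof.
by move=> mq; apply: measurable_funB => //; exact: measurable_fun_ln.
Qed.

Lemma plan_has_c12 Q q : three_plan Q q ->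
  has_expect Q (fun w => c12 w.1.1 w.1.2).
Proof.
move=> [_ l1 l2].
have sa : has_expect Q (fun w => alpha w.1.1).
  exact/(has_expect_law measurable_p11 l1 (has_expect_measurable alphaL)).
have sb : has_expect Q (fun w => beta w.1.2).
  exact/(has_expect_law measurable_p12 l2 (has_expect_measurable betaL)).
apply: (has_expect_between _ (has_expect_cst Q 0) (has_expectD sa sb)).
  exact: (measurableT_comp mc12).
by apply: aeW => w; rewrite c12_ge0 c12_le.
Qed.

Lemma integral_weighted_bridge (p : T1 * T2 -> R) : measurable_fun setT p ->
  (forall v, 0 <= p v)%R ->
  \int[m3]_w (p w.1 * g w)%:E = \int[pprod mu nu]_v (p v)%:E.
Proof.
move=> mp p0; rewrite (sfprod_tonelli1 (pprod mu nu) lam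
  (f := fun w => (p w.1 * g w)%:E)); last 2 first.
- apply/measurable_EFinP; apply: measurable_funM => //.
  exact: (measurableT_comp mp).
- by move=> w; rewrite lee_fin mulr_ge0// ltW.
apply: eq_integral => v _ /=; under eq_integral do rewrite EFinM.
rewrite ge0_integralZl//; last 3 first.
- by apply/measurable_EFinP; exact: measurableT_comp.
- by move=> z _; rewrite lee_fin ltW.
- by rewrite lee_fin.
by rewrite g1 mule1.
Qed.

Lemma plan_law_coupling Q q P : three_plan Q q -> has_law Q fst P ->
  is_coupling mu nu P.
Proof. by move=> [_ l1 l2] lP; exact: (law_coupling l1 l2 lP). Qed.

Lemma plan_dominated Q q P : three_plan Q q -> has_law Q fst P ->
  P `<< pprod mu nu.
Proof.
move=> [dq _ _] lP; apply/null_content_dominatesP => N mN N0.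
have /null_content_dominatesP Qm := density_dominates dq.
rewrite -lP//; apply: Qm.
  by rewrite -[X in measurable X]setTI; exact: measurable_fst.
rewrite -setXT; transitivity (((pprod mu nu) \x lam) (N `*` setT)) => //.
by rewrite product_measure1E// [X in X * _]N0 mul0e.
Qed.

(** Gibbs' inequality against [p (x, y) * g ((x, y), z)], with [p] the density of
    the endpoint marginal: replacing the conditional law of the midpoint by the
    bridge does not increase the entropy. *)
Lemma plan_cost_ge_EOT Q q : three_plan Q q -> has_expect Q (excess q) ->
  EOT eps c12 mu nu <= (plan_cost Q q)%:E.
Proof.
move=> pl sL; have [dq l1 l2] := pl.
have [P lP] := exists_law Q (@measurable_fst _ _ (T1 * T2)%type T3).
apply: le_trans (EOT_le _ _ (plan_law_coupling pl lP)) _.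
have [p dp KE] := KL_density (plan_dominated pl lP).
have [mp p0 _] := dp.
have mlp : measurable_fun setT (fun v => ln (p v)) by exact: measurable_fun_ln.
have [w1 [sw1 _ lb]] := probability_density_lb dp.
have ppos : {ae Q, forall w, (0 < p w.1)%R}.
  exact: (ae_law measurable_fst lP (density_gt0_ae dp)).
have [||||w2 [sw2 w20 ub]] := @gibbs _ _ _ _ _ _ (fun w => p w.1 * g w)%R dq _ _ _ _.
- apply: measurable_funM => //; exact: (measurableT_comp mp).
- by move=> w; rewrite mulr_ge0// ltW.
- by rewrite integral_weighted_bridge// (density_integral1 dp).
- by move: ppos; apply: filterS => w pw; rewrite mulr_gt0.
have ub' : {ae Q, forall w, (ln (p w.1) <= excess q w + w2 w)%R}.
  move: ppos ub; apply: filterS2 => w pw.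
  by rewrite lnM ?posrE// /excess; lra.
have sp : has_expect Q ((fun v => ln (p v)) \o fst).
  have sw1' : has_expect Q (w1 \o fst).
    exact/(has_expect_law measurable_fst lP (has_expect_measurable sw1)).
  apply: (has_expect_between _ (has_expectN sw1') (has_expectD sL sw2)).
    exact: (measurableT_comp mlp).
  have lb' := ae_law measurable_fst lP lb.
  by move: lb' ub'; apply: filterS2 => w /= -> ->.
have spP : has_expect P (fun v => ln (p v)).
  exact/(has_expect_law measurable_fst lP mlp).
have sc := plan_has_c12 pl.
have scP : has_expect P (fun v => c12 v.1 v.2).
  exact/(has_expect_law measurable_fst lP mc12).
rewrite (eot_costE eps dp KE scP spP) lee_fin /plan_cost.
rewrite -(expect_law measurable_fst lP mc12) -(expect_law measurable_fst lP mlp).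
rewrite lerD2l ler_pM2l//; apply: le_trans (le_expect sp (has_expectD sL sw2) ub') _.
by rewrite expectD//; move: w20; lra.
Qed.

(** Filling an optimal endpoint plan with bridges adds no relative entropy, so
    that the resulting plan has the optimal cost; its midpoint marginal is a
    mixture of bridges. *)
Lemma optimal_bridge_mixture (P : probability (T1 * T2)%type R) :
  is_optimal_plan eps c12 mu nu P ->
  exists Q q, [/\ three_plan Q q, has_expect Q (excess q),
    (plan_cost Q q)%:E = EOT eps c12 mu nu,
    (has_expect Q (fun w => c1 w.1.1 w.2) /\
     has_expect Q (fun w => c2 w.1.2 w.2)) &
    forall A, measurable A ->
      Q (snd @^-1` A) = \int[lam]_(z in A) \int[P]_v (g (v, z))%:E].
Proof.
move=> [[cP1 cP2] optP].
have sc12 : has_expect (pprod mu nu) (fun v => c12 v.1 v.2).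
  have lf : has_law (pprod mu nu) fst mu by case: (pprod_coupling mu nu).
  have ls : has_law (pprod mu nu) snd nu by case: (pprod_coupling mu nu).
  have sa : has_expect (pprod mu nu) (alpha \o fst).
    exact/(has_expect_law measurable_fst lf (has_expect_measurable alphaL)).
  have sb : has_expect (pprod mu nu) (beta \o snd).
    exact/(has_expect_law measurable_snd ls (has_expect_measurable betaL)).
  apply: (has_expect_between mc12 (has_expect_cst _ 0) (has_expectD sa sb)).
  by apply: aeW => w; rewrite c12_ge0 c12_le.
have /(eot_cost_fin eps_gt0 c12_ge0 mc12)[p [dp scP slp PE]] :
    eot_cost eps c12 mu nu P < +oo.
  rewrite optP; apply: EOT_lty => //; rewrite -expectE ?ltry//.
have [mp p0 _] := dp.
have mlp : measurable_fun setT (fun v => ln (p v)) by exact: measurable_fun_ln.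
pose q (w : T) := (p w.1 * g w)%R.
have mpf : measurable_fun setT (fun w : T => p w.1) by exact: measurableT_comp.
have mq : measurable_fun setT q by exact: measurable_funM.
have q0 w : (0 <= q w)%R by rewrite mulr_ge0// ltW.
have q1 : \int[m3]_w (q w)%:E = 1.
  by rewrite integral_weighted_bridge// (density_integral1 dp).
have [Q dQ] := exists_density mq q0 q1.
have QE (G : T -> \bar R) : measurable_fun setT G -> (forall w, 0 <= G w) ->
    \int[Q]_w G w = \int[P]_v \int[lam]_z (G (v, z) * (g (v, z))%:E).
  move=> mG G0; rewrite (density_integral dQ)//.
  have mGg : measurable_fun setT (fun w => G w * (g w)%:E).
    by apply: emeasurable_funM => //; exact/measurable_EFinP.
  have Gg0 w : 0 <= G w * (g w)%:E by rewrite mule_ge0// lee_fin ltW.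
  rewrite (sfprod_tonelli1 (pprod mu nu) lam (f := fun w => G w * (q w)%:E));
    last 2 first.
  - by apply: emeasurable_funM => //; exact/measurable_EFinP.
  - by move=> w; rewrite mule_ge0// lee_fin.
  rewrite (density_integral dp); last 2 first.
  - exact: (measurable_fun_fubini_tonelli_F (fun w => G w * (g w)%:E)).
  - by move=> v; apply: integral_ge0.
  apply: eq_integral => v _ /=; rewrite -ge0_integralZr//; last 2 first.
  - exact: (measurableT_comp mGg).
  - by rewrite lee_fin.
  by apply: eq_integral => z _; rewrite /q EFinM muleA muleAC.
have lP : has_law Q fst P.
  apply: law_of_integral => // G mG G0.
  rewrite QE//; last exact: measurableT_comp.
  apply: eq_integral => v _; rewrite /= ge0_integralZl//.
  - by rewrite g1 mule1.
  - by apply/measurable_EFinP; exact: measurableT_comp.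
  - by move=> z _; rewrite lee_fin ltW.
have pl : three_plan Q q.
  split=> //.
  - exact: (has_law_comp measurable_fst lP cP1).
  - exact: (has_law_comp measurable_snd lP cP2).
have slpQ : has_expect Q ((fun v => ln (p v)) \o fst).
  exact/(has_expect_law measurable_fst lP mlp).
have lpe : {ae Q, forall w, ln (p w.1) = excess q w}.
  move: (ae_law measurable_fst lP (density_gt0_ae dp)).
  apply: filterS => w pw; rewrite /excess /q lnM ?posrE//; lra.
have sL : has_expect Q (excess q).
  by apply: (has_expect_ae _ slpQ) => //; exact: measurable_excess.
have mcc : measurable_fun setT (fun w : T => c1 w.1.1 w.2 + c2 w.1.2 w.2)%R.
  apply: measurable_funD.
    exact: (measurableT_comp mc1 measurable_xz).
  exact: (measurableT_comp mc2 measurable_yz).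
have ccg0 (w : T) : (0 <= (c1 w.1.1 w.2 + c2 w.1.2 w.2) * g w)%R.
  by rewrite mulr_ge0 ?addr_ge0//; exact: ltW.
have scc : has_expect Q (fun w => c1 w.1.1 w.2 + c2 w.1.2 w.2)%R.
  apply: ge0_has_expect => //; first by move=> w; rewrite addr_ge0.
  rewrite (QE (fun w => (c1 w.1.1 w.2 + c2 w.1.2 w.2)%:E))//; last 2 first.
  - exact/measurable_EFinP.
  - by move=> w; rewrite lee_fin addr_ge0.
  have sD := has_expectD scP (has_expect_cst P D).
  apply: le_lt_trans (_ : \int[P]_v (c12 v.1 v.2 + D)%:E < +oo); last first.
    by rewrite -(expectE sD) ltry.
  apply: ge0_le_integral => //.
  - by move=> v _; apply: integral_ge0 => z _; rewrite -EFinM lee_fin ccg0.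
  - apply: (measurable_fun_fubini_tonelli_F
      (fun w => (c1 w.1.1 w.2 + c2 w.1.2 w.2)%:E * (g w)%:E)).
      by apply: emeasurable_funM; exact/measurable_EFinP.
    by move=> w; rewrite -EFinM lee_fin ccg0.
  - by apply/measurable_EFinP; exact: measurable_funD.
  - by move=> v _; under eq_integral do rewrite -EFinM; exact: bridge_cost.
exists Q, q; split => //.
- rewrite -optP PE /plan_cost.
  rewrite -(expect_law measurable_fst lP mc12) -(expect_law measurable_fst lP mlp).
  congr ((_ + eps * _)%R)%:E; apply/esym/expect_ae => //.
  + exact: (measurableT_comp mlp).
  + exact: measurable_excess.
- split.
    apply: (has_expect_between _ (has_expect_cst Q 0) scc).
      exact: (measurableT_comp mc1 measurable_xz).
    by apply: aeW => w /=; rewrite c1_ge0 lerDl c2_ge0.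
  apply: (has_expect_between _ (has_expect_cst Q 0) scc).
    exact: (measurableT_comp mc2 measurable_yz).
  by apply: aeW => w /=; rewrite c2_ge0 lerDr c1_ge0.
- move=> A mA; have mA' : measurable (snd @^-1` A : set T).
    by rewrite -[X in measurable X]setTI; exact: measurable_snd.
  rewrite -[snd @^-1` A]setIT -integral_indic//.
  have mI : measurable_fun setT (fun w : T => (\1_A w.2)%:E : \bar R).
    by apply/measurable_EFinP; exact: (measurableT_comp (measurable_indic mA)).
  rewrite (QE (fun w => (\1_A w.2)%:E))//.
  rewrite -(sfprod_tonelli1 P lam (f := fun w => (\1_A w.2)%:E * (g w)%:E));
    last 2 first.
  + by apply: emeasurable_funM => //; exact/measurable_EFinP.
  + by move=> w; rewrite mule_ge0// lee_fin// ltW.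
  rewrite sfprod_tonelli2; last 2 first.
  + by apply: emeasurable_funM => //; exact/measurable_EFinP.
  + by move=> w; rewrite mule_ge0// lee_fin// ltW.
  rewrite [RHS]integral_mkcond; apply: eq_integral => z _ /=.
  rewrite patchE indicE; case: ifPn => _ /=.
    by apply: eq_integral => v _; rewrite mul1e.
  by apply: integral0_eq => v _; rewrite mul0e.
Qed.


(** By [cost_split], the bridge density is controlled by the three costs. *)
Lemma plan_has_ln_g Q q : three_plan Q q ->
  has_expect Q (fun w => c1 w.1.1 w.2) -> has_expect Q (fun w => c2 w.1.2 w.2) ->
  has_expect Q (fun w => ln (g w)).
Proof.
move=> pl s1 s2; have s12 := plan_has_c12 pl.
have := has_expectZ eps^-1 (has_expectB (has_expectD s12 (has_expect_cst Q kappa))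
  (has_expectD s1 s2)).
move=> sg; apply: (has_expect_ae _ sg) => //; apply: aeW => -[[x y] z] /=.
by rewrite cost_split; field; rewrite gt_eqF.
Qed.

Lemma eta_dominated Q q eta : three_plan Q q -> has_law Q snd eta ->
  eta `<< lam.
Proof.
move=> [dq _ _] leta; apply/null_content_dominatesP => N mN N0.
have /null_content_dominatesP Qm := density_dominates dq.
rewrite -leta//; apply: Qm.
  by rewrite -[X in measurable X]setTI; exact: measurable_snd.
rewrite -setTX; transitivity (((pprod mu nu) \x lam) (setT `*` N)) => //.
by rewrite product_measure1E// [X in _ * X]N0 mule0.
Qed.

Lemma law_dominated1 (Q : probability T R) P : Q `<< m3 -> has_law Q xz P ->
  P `<< sfprod mu lam.
Proof.
move=> /null_content_dominatesP Qm lP; apply/null_content_dominatesP => N mN N0.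
have mxN : measurable (xz @^-1` N).
  by rewrite -[X in measurable X]setTI; exact: measurable_toxz.
have mI : measurable_fun setT (fun v : T1 * T3 => (\1_N v)%:E : \bar R).
  exact/measurable_EFinP/measurable_indic.
rewrite -lP//; apply: Qm => //.
have := integral_indic m3 measurableT mxN; rewrite setIT => /esym E; apply: (etrans E).
transitivity (\int[m3]_w ((\1_N (w.1.1, w.2))%:E * 1 * 1)).
  by apply: eq_integral => w _; rewrite !mule1 !indicE.
rewrite (@ge0_integral_conditional_product _ _ _ _ _ _ _ mu nu lam
  (fun v => (\1_N v)%:E) (fun=> 1) (fun=> 1))//.
rewrite -[RHS]N0 -[N]setIT -[RHS]integral_indic//.
rewrite (sfprod_tonelli2 mu lam (f := fun v => (\1_N v)%:E))//.
apply: eq_integral => z _; rewrite mule1 (integral_cst nu measurableT 1) mul1e.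
by rewrite [X in _ * X](@probability_setT _ _ _ nu) mule1 setIT.
Qed.

Lemma law_dominated2 (Q : probability T R) P : Q `<< m3 -> has_law Q yz P ->
  P `<< sfprod nu lam.
Proof.
move=> /null_content_dominatesP Qm lP; apply/null_content_dominatesP => N mN N0.
have mxN : measurable (yz @^-1` N).
  by rewrite -[X in measurable X]setTI; exact: measurable_toyz.
have mI : measurable_fun setT (fun v : T2 * T3 => (\1_N v)%:E : \bar R).
  exact/measurable_EFinP/measurable_indic.
rewrite -lP//; apply: Qm => //.
have := integral_indic m3 measurableT mxN; rewrite setIT => /esym E; apply: (etrans E).
transitivity (\int[m3]_w (1 * (\1_N (w.1.2, w.2))%:E * 1)).
  by apply: eq_integral => w _; rewrite mule1 mul1e !indicE.
rewrite (@ge0_integral_conditional_product _ _ _ _ _ _ _ mu nu lam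
  (fun=> 1) (fun v => (\1_N v)%:E) (fun=> 1))//.
rewrite -[RHS]N0 -[N]setIT -[RHS]integral_indic//.
rewrite (sfprod_tonelli2 nu lam (f := fun v => (\1_N v)%:E))//.
apply: eq_integral => z _; rewrite mule1 (integral_cst mu measurableT 1) mul1e.
by rewrite [X in X * _](@probability_setT _ _ _ mu) mul1e setIT.
Qed.


Let measurable_z : measurable_fun setT (snd : T -> T3).
Proof. exact: measurable_snd. Qed.

Lemma expect_cost_split Q q : three_plan Q q ->
  has_expect Q (fun w => c1 w.1.1 w.2) -> has_expect Q (fun w => c2 w.1.2 w.2) ->
  (expect Q (fun w => c1 w.1.1 w.2) + expect Q (fun w => c2 w.1.2 w.2) =
   expect Q (fun w => c12 w.1.1 w.1.2) - eps * expect Q (fun w => ln (g w)) +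
   kappa)%R.
Proof.
move=> pl s1 s2; have s12 := plan_has_c12 pl; have sg := plan_has_ln_g pl s1 s2.
rewrite -expectD// -expectZ// -expectB//; last exact: has_expectZ.
rewrite -[X in (_ = _ + X)%R](expect_cst Q) -expectD//.
- congr expect; apply/funext => -[[x y] z] /=; exact: cost_split.
- by apply: has_expectB => //; exact: has_expectZ.
- exact: has_expect_cst.
Qed.

(** The entropies of the two couplings and of the midpoint add up to at most
    the entropy of the plan, the difference being the conditional mutual
    information of the endpoints given the midpoint. This is Gibbs' inequality
    against the plan glued from the marginals. *)
Lemma interpolation_le Q q eta : three_plan Q q -> has_expect Q (excess q) ->
  has_expect Q (fun w => c1 w.1.1 w.2) -> has_expect Q (fun w => c2 w.1.2 w.2) ->
  has_law Q snd eta -> interpolation eta <= (plan_cost Q q + kappa)%:E.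
Proof.
move=> pl sL s1 s2 leta; have [dq l1 l2] := pl.
have [P1 lP1] := exists_law Q measurable_xz.
have [P2 lP2] := exists_law Q measurable_yz.
have cP1 : is_coupling mu eta P1 by exact: (law_coupling (phi := xz) l1 leta lP1).
have cP2 : is_coupling nu eta P2 by exact: (law_coupling (phi := yz) l2 leta lP2).
have [[_ eP1] [_ eP2]] := (cP1, cP2).
have Qm := density_dominates dq; have etalam := eta_dominated pl leta.
have [f1 df1 K1] := KL_density
  (dominated_by_marginal (law_dominated1 Qm lP1) eP1 etalam).
have [f2 df2 K2] := KL_density
  (dominated_by_marginal (law_dominated2 Qm lP2) eP2 etalam).
have [h dh K3] := KL_density etalam.
have [[[mf1 f10 _] [mf2 f20 _]] [mh h0 _]] := (df1, df2, dh).
have [mq q0 _] := dq.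
have mlf1 : measurable_fun setT (fun v => ln (f1 v)) by exact: measurable_fun_ln.
have mlf2 : measurable_fun setT (fun v => ln (f2 v)) by exact: measurable_fun_ln.
have mlh : measurable_fun setT (fun z => ln (h z)) by exact: measurable_fun_ln.
have pf1 := ae_law measurable_xz lP1 (density_gt0_ae df1).
have pf2 := ae_law measurable_yz lP2 (density_gt0_ae df2).
have ph := ae_law measurable_z leta (density_gt0_ae dh).
(* Making some factors of a glued density trivial gives the densities [h],
   [f1 * h] and [f2 * h]; Gibbs' inequality against them bounds the logarithm of
   each factor from above. *)
have d11 := density_self (pprod mu eta); have d12 := density_self (pprod nu eta).
have e12 : has_law (pprod nu eta) snd eta by case: (pprod_coupling nu eta).
have [|w4 [sw4 _ ub4]] := gibbs dq (measurable_glued d11 d12 dh)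
  (glued_ge0 d11 d12 dh) (eq_le1 (integral_glued d11 d12 dh e12)).
  by move: ph; apply: filterS => w hw; rewrite /glued !mul1r.
have [|w5 [sw5 _ ub5]] := gibbs dq (measurable_glued df1 d12 dh)
  (glued_ge0 df1 d12 dh) (eq_le1 (integral_glued df1 d12 dh e12)).
  by move: pf1 ph; apply: filterS2 => w f1w hw; rewrite /glued mulr1 mulr_gt0.
have [|w6 [sw6 _ ub6]] := gibbs dq (measurable_glued d11 df2 dh)
  (glued_ge0 d11 df2 dh) (eq_le1 (integral_glued d11 df2 dh eP2)).
  by move: pf2 ph; apply: filterS2 => w f2w hw; rewrite /glued mul1r mulr_gt0.
have pgl : {ae Q, forall w, (0 < glued f1 f2 h w)%R}.
  by move: pf1 pf2 ph; apply: filterS3 => w f1w f2w hw; rewrite /glued !mulr_gt0.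
have sg := plan_has_ln_g pl s1 s2.
have slq : has_expect Q (fun w => ln (q w)).
  apply: (has_expect_ae _ (has_expectD sL sg)); first exact: measurable_fun_ln.
  by apply: aeW => w; rewrite /excess /= subrK.
(* [r] bounds [ln h] from below, [q] bounds it from above. *)
have slh : has_expect Q ((fun z => ln (h z)) \o snd).
  have [w3 [sw3 _ lb3]] := gibbs dh mr (fun z => ltW (r_gt0 z)) r_le1
    (aeW _ r_gt0).
  have sw3' : has_expect Q (w3 \o snd).
    exact/(has_expect_law measurable_z leta (has_expect_measurable sw3)).
  have sa : has_expect Q (fun w => alpha w.1.1).
    exact/(has_expect_law measurable_p11 l1 (has_expect_measurable alphaL)).
  have sC := has_expectN (has_expectD (has_expectZ C (has_expectD
    (has_expectD sa s1) (has_expect_cst Q 1%R))) sw3').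
  apply: (has_expect_between _ sC (has_expectD slq sw4)).
    exact: measurableT_comp.
  have lb3' := ae_law measurable_z leta lb3.
  move: lb3' ub4; apply: filterS2 => w /= h1; rewrite /glued !mul1r => h2.
  by have rw := r_lb w.1.1 w.2; apply/andP; split => /=; move: rw h1 h2; lra.
have slf1 : has_expect Q ((fun v => ln (f1 v)) \o xz).
  have [w1 [sw1 _ lb1]] := probability_density_lb df1.
  have sw1' : has_expect Q (w1 \o xz).
    exact/(has_expect_law measurable_xz lP1 (has_expect_measurable sw1)).
  apply: (has_expect_between _ (has_expectN sw1')
    (has_expectD (has_expectB slq slh) sw5)).
    exact: (measurableT_comp mlf1 measurable_xz).
  have lb1' := ae_law measurable_xz lP1 lb1.
  have pfh : {ae Q, forall w, (0 < f1 (xz w))%R /\ (0 < h w.2)%R}.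
    by move: pf1 ph; apply: filterS2.
  move: pfh; move: lb1' ub5; apply: filterS3 => w /= h1.
  rewrite /glued mulr1 => h2 [f1w hw]; move: h2.
  by rewrite lnM ?posrE// => h2; exact: trap_summand.
have slf2 : has_expect Q ((fun v => ln (f2 v)) \o yz).
  have [w2 [sw2 _ lb2]] := probability_density_lb df2.
  have sw2' : has_expect Q (w2 \o yz).
    exact/(has_expect_law measurable_yz lP2 (has_expect_measurable sw2)).
  apply: (has_expect_between _ (has_expectN sw2')
    (has_expectD (has_expectB slq slh) sw6)).
    exact: (measurableT_comp mlf2 measurable_yz).
  have lb2' := ae_law measurable_yz lP2 lb2.
  have pfh : {ae Q, forall w, (0 < f2 (yz w))%R /\ (0 < h w.2)%R}.
    by move: pf2 ph; apply: filterS2.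
  move: pfh; move: lb2' ub6; apply: filterS3 => w /= h1.
  rewrite /glued mul1r => h2 [f2w hw]; move: h2.
  by rewrite lnM ?posrE// => h2; exact: trap_summand.
have sum3 := has_expectD (has_expectD slf1 slf2) slh.
have lngl : {ae Q, forall w, ln (glued f1 f2 h w) =
    (ln (f1 (xz w)) + ln (f2 (yz w)) + ln (h w.2))%R}.
  move: pf1 pf2 ph; apply: filterS3 => w f1w f2w hw.
  by rewrite /glued lnM ?posrE ?mulr_gt0// lnM ?posrE.
have mgl := measurable_glued df1 df2 dh.
have sgl : has_expect Q (fun w => ln (glued f1 f2 h w)).
  apply: (has_expect_ae _ sum3); first exact: measurable_fun_ln.
  by move: lngl; apply: filterS => w ->.
have chain := gibbs_le dq mgl (glued_ge0 df1 df2 dh)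
  (eq_le1 (integral_glued df1 df2 dh eP2)) pgl (has_expectB sgl slq).
have Egl : expect Q (fun w => ln (glued f1 f2 h w)) =
    (expect P1 (fun v => ln (f1 v)) + expect P2 (fun v => ln (f2 v)) +
     expect eta (fun z => ln (h z)))%R.
  rewrite -(expect_law measurable_xz lP1 mlf1) -(expect_law measurable_yz lP2 mlf2).
  rewrite -(expect_law measurable_z leta mlh) -expectD// -expectD//; last first.
    exact: has_expectD.
  apply: expect_ae => //; first exact: measurable_fun_ln.
  exact: (has_expect_measurable sum3).
have s1P : has_expect P1 (fun v => c1 v.1 v.2).
  exact/(has_expect_law measurable_xz lP1 mc1).
have s2P : has_expect P2 (fun v => c2 v.1 v.2).
  exact/(has_expect_law measurable_yz lP2 mc2).
have slf1P : has_expect P1 (fun v => ln (f1 v)).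
  exact/(has_expect_law measurable_xz lP1 mlf1).
have slf2P : has_expect P2 (fun v => ln (f2 v)).
  exact/(has_expect_law measurable_yz lP2 mlf2).
have slheta : has_expect eta (fun z => ln (h z)).
  exact/(has_expect_law measurable_z leta mlh).
have E1 := EOT_le eps c1 cP1; rewrite (eot_costE eps df1 K1 s1P slf1P) in E1.
have E2 := EOT_le eps c2 cP2; rewrite (eot_costE eps df2 K2 s2P slf2P) in E2.
rewrite /interpolation (KL_fin_density dh K3 slheta) -EFinM.
apply: le_trans (dadde_EFin_le _ (leeD E1 E2)) _; rewrite lee_fin.
rewrite (expectB sgl slq) Egl in chain.
rewrite -(expect_law measurable_xz lP1 mc1) -(expect_law measurable_yz lP2 mc2).
have Ecost := expect_cost_split pl s1 s2.
rewrite /plan_cost (_ : expect Q (excess q) =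
  expect Q (fun w => ln (q w)) - expect Q (fun w => ln (g w)))%R; last first.
  by rewrite -expectB.
have := mulr_ge0_le0 (ltW eps_gt0) chain; move: Ecost.
rewrite /comp /=; set F1 := expect P1 _; set F2 := expect P2 _.
set H := expect eta _; lra.
Qed.

(** Gluing near-optimal couplings of [eta] with the two endpoint laws gives a
    plan whose cost is, up to [kappa], the sum of the three terms of the
    functional. *)
Lemma exists_near_plan eta (delta : R) : (0 < delta)%R ->
  interpolation eta < +oo ->
  exists Q q, [/\ three_plan Q q, has_expect Q (excess q), has_law Q snd eta &
    (plan_cost Q q + kappa)%:E <= interpolation eta + delta%:E].
Proof.
move=> delta0 Foo.
have E10 := EOT_ge0 eps_gt0 c1_ge0 mu eta.
have E20 := EOT_ge0 eps_gt0 c2_ge0 nu eta.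
have [E1oo E2oo Koo] := dadde3_lty eps_gt0 E10 E20 Foo.
have delta2 : (0 < delta / 2)%R by rewrite divr_gt0.
have [P1 cP1 P1le] := EOT_adherent eps_gt0 c1_ge0 delta2 E1oo.
have [P2 cP2 P2le] := EOT_adherent eps_gt0 c2_ge0 delta2 E2oo.
have [f1 [df1 s1P slf1P PE1]] := eot_cost_fin eps_gt0 c1_ge0 mc1
  (le_lt_trans P1le (lte_add_pinfty E1oo (ltry _))).
have [f2 [df2 s2P slf2P PE2]] := eot_cost_fin eps_gt0 c2_ge0 mc2
  (le_lt_trans P2le (lte_add_pinfty E2oo (ltry _))).
have etalam : eta `<< lam.
  by apply: contrapT => n; move: Koo; rewrite /KL asboolF.
have [h dh K3] := KL_density etalam.
have eP1 : has_law P1 snd eta by case: cP1.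
have eP2 : has_law P2 snd eta by case: cP2.
have [Q [dQ lP1 lP2]] := exists_glued df1 df2 dh eP1 eP2.
have leta : has_law Q snd eta by exact: (has_law_comp measurable_snd lP1 eP1).
have pl : three_plan Q (glued f1 f2 h).
  split=> //.
  - by apply: (has_law_comp measurable_fst lP1); case: cP1.
  - by apply: (has_law_comp measurable_fst lP2); case: cP2.
have [[[mf1 f10 _] [mf2 f20 _]] [mh h0 _]] := (df1, df2, dh).
have mlf1 : measurable_fun setT (fun v => ln (f1 v)) by exact: measurable_fun_ln.
have mlf2 : measurable_fun setT (fun v => ln (f2 v)) by exact: measurable_fun_ln.
have mlh : measurable_fun setT (fun z => ln (h z)) by exact: measurable_fun_ln.
have mgl := measurable_glued df1 df2 dh.
have s1 : has_expect Q (fun w => c1 w.1.1 w.2).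
  exact/(has_expect_law measurable_xz lP1 mc1).
have s2 : has_expect Q (fun w => c2 w.1.2 w.2).
  exact/(has_expect_law measurable_yz lP2 mc2).
have slf1 : has_expect Q ((fun v => ln (f1 v)) \o xz).
  exact/(has_expect_law measurable_xz lP1 mlf1).
have slf2 : has_expect Q ((fun v => ln (f2 v)) \o yz).
  exact/(has_expect_law measurable_yz lP2 mlf2).
have sg := plan_has_ln_g pl s1 s2.
have lngl : {ae Q, forall w, ln (glued f1 f2 h w) =
    (ln (f1 (xz w)) + ln (f2 (yz w)) + ln (h w.2))%R}.
  have pf1 := ae_law measurable_xz lP1 (density_gt0_ae df1).
  have pf2 := ae_law measurable_yz lP2 (density_gt0_ae df2).
  have ph := ae_law measurable_z leta (density_gt0_ae dh).
  move: pf1 pf2 ph; apply: filterS3 => w f1w f2w hw.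
  by rewrite /glued lnM ?posrE ?mulr_gt0// lnM ?posrE.
(* [ln h] is bounded below because the glued density satisfies Gibbs' inequality
   against the bridge; the finiteness of the entropy of [eta] does the rest. *)
have slh : has_expect Q ((fun z => ln (h z)) \o snd).
  have gint : \int[m3]_w (g w)%:E = 1.
    rewrite -(density_integral1 (density_self (pprod mu nu))).
    rewrite -(integral_weighted_bridge (p := fun=> 1%R))//.
    by apply: eq_integral => w _; rewrite mul1r.
  have [w4 [sw4 _ ub4]] := gibbs dQ mg (fun w => ltW (g_gt0 w)) (eq_le1 gint)
    (aeW _ g_gt0).
  apply: (has_expect_lty _ (has_expectB (has_expectB (has_expectB sg sw4) slf1) slf2)).
  - exact: measurableT_comp.
  - by move: lngl ub4; apply: filterS2 => w /= e; rewrite e; lra.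
  - by rewrite (integral_law measurable_z leta mlh) -K3.
have sum4 := has_expectB (has_expectD (has_expectD slf1 slf2) slh) sg.
have sLae : {ae Q, forall w, ((ln (f1 (xz w)) + ln (f2 (yz w)) + ln (h w.2)) -
    ln (g w))%R = excess (glued f1 f2 h) w}.
  by move: lngl; apply: filterS => w e; rewrite /excess e.
have sL : has_expect Q (excess (glued f1 f2 h)).
  by apply: (has_expect_ae _ sum4) => //; exact: measurable_excess.
exists Q, (glued f1 f2 h); split => //.
have EL : expect Q (excess (glued f1 f2 h)) =
    (expect P1 (fun v => ln (f1 v)) + expect P2 (fun v => ln (f2 v)) +
     expect eta (fun z => ln (h z)) - expect Q (fun w => ln (g w)))%R.
  rewrite -(expect_law measurable_xz lP1 mlf1) -(expect_law measurable_yz lP2 mlf2).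
  rewrite -(expect_law measurable_z leta mlh) -!expectD//; last exact: has_expectD.
  rewrite -expectB//; last by apply: has_expectD => //; exact: has_expectD.
  apply/esym/expect_ae => //; first exact: (has_expect_measurable sum4).
  exact: measurable_excess.
have Ecost := expect_cost_split pl s1 s2.
have slheta : has_expect eta (fun z => ln (h z)).
  exact/(has_expect_law measurable_z leta mlh).
move: P1le P2le; rewrite PE1 PE2 -(expect_law measurable_xz lP1 mc1).
rewrite -(expect_law measurable_yz lP2 mc2).
rewrite /interpolation (KL_fin_density dh K3 slheta) /plan_cost EL.
move: E10 E1oo E20 E2oo; case: (EOT eps c1 mu eta) => [a| |]// _ _.
case: (EOT eps c2 nu eta) => [b| |]// _ _; rewrite -!EFinD !lee_fin => P1le P2le.
change ((expect Q (fun w => c12 w.1.1 w.1.2) + eps *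
  (expect P1 (fun v => ln (f1 v)) + expect P2 (fun v => ln (f2 v)) +
     expect eta (fun z => ln (h z)) - expect Q (fun w => ln (g w))) + kappa)%:E <=
  (a + b + eps * expect eta (fun z => ln (h z)) + delta)%:E).
rewrite lee_fin; move: P1le P2le Ecost; rewrite /comp /=.
set F1 := expect P1 _; set F2 := expect P2 _; set H := expect eta _.
set X1 := expect Q (fun w => c1 _ _); set X2 := expect Q (fun w => c2 _ _).
lra.
Qed.


Let stability_arith (V delta s a a' b cQ cQ' lQ lQ' gQ gQ' : R) :
  (cQ + eps * lQ <= V + delta -> cQ' + eps * lQ' <= V ->
   b = (a + a') / 2 -> s * (a - b) <= 2 * s ^+ 2 - gQ -> gQ' <= 0 ->
   V <= (cQ + cQ') / 2 + eps * ((lQ + gQ + (lQ' + gQ')) / 2) ->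
   s * (a - a') <= 2 * delta / eps + 4 * s ^+ 2)%R.
Proof.
move=> costQ costQ' -> tilted gap' VV.
have convex : (0 <= delta + eps * gQ)%R.
  by have := mulr_ge0_le0 (ltW eps_gt0) gap'; lra.
have : (- gQ <= delta / eps)%R by rewrite ler_pdivlMr//; lra.
rewrite -mulrA; lra.
Qed.

(** Quantitative uniqueness by strict convexity: the midpoint of two plans is
    again a plan, and the gap in the convexity inequality is a relative entropy
    with respect to the midpoint, which controls the difference of the two plans
    on any event. *)
Lemma plan_stability Q q Q' q' (V delta s : R) (A : set T) :
  three_plan Q q -> has_expect Q (excess q) ->
  three_plan Q' q' -> has_expect Q' (excess q') ->
  EOT eps c12 mu nu = V%:E -> (plan_cost Q q <= V + delta)%R ->
  (plan_cost Q' q' <= V)%R -> measurable A -> (`|s| <= 2^-1)%R ->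
  (s * (fine (Q A) - fine (Q' A)) <= 2 * delta / eps + 4 * s ^+ 2)%R.
Proof.
move=> pl sL pl' sL' EV costQ costQ' mA s2.
have [dq l1 l2] := pl; have [dq' l1' l2'] := pl'.
have [[mq q0 _] [mq' q0' _]] := (dq, dq').
have [M dM ME] := exists_midpoint dq dq'; set m := (fun w => _) in dM.
have [mm m0 _] := dM.
have MB B : measurable B -> M B = 2^-1%:E * (Q B + Q' B).
  move=> mB; rewrite -[B]setIT -!integral_indic// ME//.
  exact/measurable_EFinP/measurable_indic.
have half (x : \bar R) : x \is a fin_num -> 2^-1%:E * (x + x) = x.
  by case: x => // x _; rewrite -EFinD -EFinM; congr EFin; field.
have plM : three_plan M m.
  split=> // B mB.
    rewrite MB; last by rewrite -[X in measurable X]setTI; exact: measurable_p11.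
    by rewrite l1// l1'// half// fin_num_measure.
  rewrite MB; last by rewrite -[X in measurable X]setTI; exact: measurable_p12.
  by rewrite l2// l2'// half// fin_num_measure.
have [mposQ gapQ] : {ae Q, forall w, (0 < m w)%R} /\
    has_expect Q (fun w => ln (m w) - ln (q w))%R.
  by apply: (has_expect_midpoint dq dM) => w; rewrite ler_pM2r ?lerDl.
have [mposQ' gapQ'] : {ae Q', forall w, (0 < m w)%R} /\
    has_expect Q' (fun w => ln (m w) - ln (q' w))%R.
  by apply: (has_expect_midpoint dq' dM) => w; rewrite ler_pM2r ?lerDr.
have excessE (p : T -> R) :
    excess m = (excess p \+ (fun w => ln (m w) - ln (p w)))%R.
  by apply/funext => w; rewrite /excess /=; ring.
have smQ : has_expect Q (excess m) by rewrite (excessE q); exact: has_expectD.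
have smQ' : has_expect Q' (excess m) by rewrite (excessE q'); exact: has_expectD.
have sM := has_expect_mixture ME smQ smQ'.
have gap' := gibbs_le dq' mm m0 (eq_le1 (density_integral1 dM)) mposQ' gapQ'.
have tilted := entropy_ge_event dq dM mposQ gapQ mA s2.
have [sAQ EAQ] := expect_indic Q mA; have [sAQ' EAQ'] := expect_indic Q' mA.
rewrite -EAQ -EAQ' /=.
apply: (stability_arith costQ costQ' (expect_mixture ME sAQ sAQ') tilted gap').
have := plan_cost_ge_EOT plM sM; rewrite EV lee_fin /plan_cost.
rewrite (expect_mixture ME (plan_has_c12 pl) (plan_has_c12 pl')).
rewrite (expect_mixture ME smQ smQ').
have := congr1 (expect Q) (excessE q); rewrite (expectD sL gapQ) => ->.
by have := congr1 (expect Q') (excessE q'); rewrite (expectD sL' gapQ') => ->.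
Qed.

Theorem interpolation_minimizer (P : probability (T1 * T2)%type R) :
  is_optimal_plan eps c12 mu nu P ->
  exists eta, is_unique_minimizer interpolation eta /\
    has_density eta lam (fun z => \int[P]_v (g (v, z))%:E).
Proof.
move=> optP; have [Q [q [pl sL EV [s1 s2] Qz]]] := optimal_bridge_mixture optP.
have [eta leta] := exists_law Q measurable_z.
have Fle := interpolation_le pl sL s1 s2 leta.
have near eta' (delta : R) : (0 < delta)%R ->
    interpolation eta' < +oo -> exists Q' q', [/\ three_plan Q' q',
      has_expect Q' (excess q'), has_law Q' snd eta' &
      (plan_cost Q' q' + kappa)%:E <= interpolation eta' + delta%:E].
  exact: exists_near_plan.
exists eta; split; last by move=> A mA; rewrite -leta// Qz.
split=> [eta'|eta' min' A mA].
  have [Foo|] := ltP (interpolation eta') +oo; last first.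
    by rewrite leye_eq => /eqP ->; rewrite leey.
  apply: (le_trans Fle); apply/lee_addgt0Pr => delta delta0.
  have [Q' [q' [pl' sL' _]]] := near eta' delta delta0 Foo.
  apply: le_trans; rewrite lee_fin lerD2r.
  by rewrite -lee_fin EV; exact: plan_cost_ge_EOT.
have F'le : interpolation eta' <= (plan_cost Q q + kappa)%:E.
  exact: le_trans (min' eta) Fle.
have mA' : measurable (snd @^-1` A : set T).
  by rewrite -[X in measurable X]setTI; exact: measurable_z.
pose dist := (fine (eta' A) - fine (eta A))%R.
have small (delta s : R) : (0 < delta)%R -> (`|s| <= 2^-1)%R ->
    (s * dist <= 2 * delta / eps + 4 * s ^+ 2)%R.
  move=> delta0 s2'.
  have [Q' [q' [pl' sL' leta' cost']]] := near eta' delta delta0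
    (le_lt_trans F'le (ltry _)).
  rewrite /dist -leta// -leta'//.
  apply: (plan_stability pl' sL' pl sL (esym EV)) => //.
  have : (plan_cost Q' q' + kappa)%:E <= (plan_cost Q q + kappa)%:E + delta%:E.
    by apply: (le_trans cost'); rewrite leeD2r.
  by rewrite -EFinD lee_fin; lra.
have fin1 (P' : probability T3 R) : (0 <= fine (P' A) <= 1)%R.
  rewrite -!lee_fin fineK ?fin_num_measure//.
  by rewrite measure_ge0 probability_le1.
have dist0 : dist = 0%R.
  apply/eqP; rewrite -[_ == _]negbK; apply/negP => d0.
  have dd : (0 < dist ^+ 2)%R by rewrite exprn_even_gt0.
  have [/andP[a0 a1] /andP[b0 b1]] := (fin1 eta, fin1 eta').
  (* For [s] of order [dist] and [delta] of order [dist ^+ 2], the inequality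
     [small] fails unless [dist] vanishes. *)
  have h1 : (0 < eps * (dist ^+ 2 / 128))%R by rewrite mulr_gt0// divr_gt0.
  have h2 : (`|dist / 16| <= 2^-1)%R.
    by rewrite ler_norml /dist; apply/andP; split; lra.
  have := small _ _ h1 h2.
  have -> : (2 * (eps * (dist ^+ 2 / 128)) / eps = dist ^+ 2 / 64)%R.
    by field; rewrite gt_eqF.
  by move: dd; rewrite !expr2; nra.
by rewrite -[LHS]fineK ?fin_num_measure// -[RHS]fineK ?fin_num_measure//;
  congr EFin; move: dist0; rewrite /dist; lra.
Qed.

End three_marginals.

(** * Brownian bridges in Euclidean space *)

Section euclidean.
Import Order.TTheory GRing.Theory Num.Theory.
Import numFieldNormedType.Exports.
Local Open Scope classical_set_scope.
Local Open Scope ring_scope.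
Local Open Scope ereal_scope.
Context (R : realType).

Lemma measurable_sqdist (d : nat) (d' : measure_display) (T : measurableType d')
    (a b : T -> Rn R d) : measurable_fun setT a -> measurable_fun setT b ->
  measurable_fun setT (fun w => sqdist (a w) (b w)).
Proof.
move=> ma mb; rewrite /sqdist; apply: measurable_sum => i.
apply: measurable_funX; apply: measurable_funB.
  exact: (measurableT_comp (measurable_tnth i) ma).
exact: (measurableT_comp (measurable_tnth i) mb).
Qed.

Lemma sqdist_ge0 (d : nat) (x y : Rn R d) : (0 <= sqdist x y)%R.
Proof. by apply: sumr_ge0 => i _; exact: sqr_ge0. Qed.

Lemma gauss_integral_line (m s : R) : (0 < s)%R ->
  \int[lebesgue_measure]_x (expR (- ((m - x) ^+ 2 / s)))%:E =
  (Num.sqrt (pi * s))%:E.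
Proof.
move=> s0; have sig0 : Num.sqrt (s / 2) != 0%R.
  by rewrite gt_eqF// sqrtr_gt0 divr_gt0.
have peak : normal_peak (Num.sqrt (s / 2)) = (Num.sqrt (pi * s))^-1%R.
  rewrite /normal_peak sqr_sqrtr; last by rewrite divr_ge0// ltW.
  by congr (Num.sqrt _)^-1%R; rewrite -mulr_natr; field.
have ps0 : (0 < Num.sqrt (pi * s))%R by rewrite sqrtr_gt0 mulr_gt0// pi_gt0.
have := integral_normal_pdf m (Num.sqrt (s / 2)); rewrite normal_pdfE//.
under eq_integral do rewrite EFinM.
rewrite peak ge0_integralZl//;
  do ?[by apply/measurable_EFinP; exact: measurable_normal_fun
      |by move=> x _; rewrite lee_fin normal_fun_ge0
      |by rewrite lee_fin invr_ge0 ltW].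
have -> : (\int[lebesgue_measure]_x (normal_fun m (Num.sqrt (s / 2)) x)%:E =
    \int[lebesgue_measure]_x (expR (- ((m - x) ^+ 2 / s)))%:E).
  apply: eq_integral => x _; congr (expR _)%:E.
  rewrite sqr_sqrtr; last by rewrite divr_ge0// ltW.
  by rewrite -mulr_natr; field; rewrite gt_eqF.
move=> e; rewrite -[LHS]mul1e -[X in X%:E * _](@divff _ (Num.sqrt (pi * s)));
  last by rewrite gt_eqF.
by rewrite EFinM -muleA e mule1.
Qed.

Lemma gauss_integral_Rn (d : nat) (m : Rn R d) (s : R) : (0 < s)%R ->
  \int[lebesgue_Rn R d]_z (expR (- (sqdist m z / s)))%:E =
  (Num.sqrt (pi * s) ^+ d)%:E.
Proof.
move=> s0; elim: d m => [|d IH] m.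
  rewrite /= integral_dirac//; last first.
    apply/measurable_EFinP; apply: measurableT_comp => //.
    apply: measurableT_comp => //; apply: measurable_funM => //.
    exact: measurable_sqdist.
  by rewrite diracT mul1e /sqdist big_ord0 mul0r oppr0 expR0 expr0.
have mf : measurable_fun setT (fun z : Rn R d.+1 => (expR (- (sqdist m z / s)))%:E).
  apply/measurable_EFinP; apply: measurableT_comp => //.
  apply: measurableT_comp => //; apply: measurable_funM => //.
  exact: measurable_sqdist.
case/tupleP: m mf => m0 m' mf.
rewrite [LHS](@ge0_integral_pushforward _ _ _ _ _ _ (@measurable_cons_Rn R d)
  (lebesgue_measure \x lebesgue_Rn R d)%E setT)//.
rewrite preimage_setT.
transitivity (\int[sfprod lebesgue_measure (lebesgue_Rn R d)]_v
  ((expR (- ((m0 - v.1) ^+ 2 / s)))%:E * (expR (- (sqdist m' v.2 / s)))%:E)).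
  apply: eq_integral => -[a b] _; rewrite /= -EFinM -expRD; congr (expR _)%:E.
  rewrite /sqdist big_ord_recl /= !tnth0 -opprD -mulrDl; congr (- (_ / s))%R.
  by congr (_ + _)%R; apply: eq_bigr => i _; rewrite /cons_Rn !tnthS.
rewrite (sfprod_tonelli1 lebesgue_measure (lebesgue_Rn R d)); last 2 first.
- by apply: emeasurable_funM; apply/measurable_EFinP; apply: measurableT_comp => //;
    apply: measurableT_comp => //; apply: measurable_funM => //;
    [apply: measurable_funX; exact: measurable_funB|exact: measurable_sqdist].
- by move=> v; rewrite -EFinM lee_fin mulr_ge0 ?expR_ge0.
transitivity (\int[lebesgue_measure]_x ((expR (- ((m0 - x) ^+ 2 / s)))%:E *
    (Num.sqrt (pi * s) ^+ d)%:E)).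
  apply: eq_integral => x _; rewrite /= -(IH m') ge0_integralZl//.
    apply/measurable_EFinP; apply: measurableT_comp => //.
    apply: measurableT_comp => //; apply: measurable_funM => //.
    exact: measurable_sqdist.
rewrite ge0_integralZr//.
- by rewrite gauss_integral_line// -EFinM exprS.
- apply/measurable_EFinP; apply: measurableT_comp => //.
  apply: measurableT_comp => //; apply: measurable_funM => //.
  by apply: measurable_funX; exact: measurable_funB.
Qed.


Section brownian_bridge.
Variables (d : nat) (eps t : R).
Hypotheses (eps_gt0 : (0 < eps)%R) (t_gt0 : (0 < t)%R) (t_lt1 : (t < 1)%R).
Implicit Types (x y z : Rn R d).

Definition bridge_mean x y : Rn R d :=
  [tuple ((1 - t) * tnth x i + t * tnth y i)%R | i < d].

Definition bridge_variance : R := (eps * t * (1 - t))%R.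
Local Notation s := bridge_variance.

Definition bridge (w : Rn R d * Rn R d * Rn R d) : R :=
  (heat_kernel eps t w.1.1 w.2 * heat_kernel eps (1 - t) w.2 w.1.2
   / heat_kernel eps 1 w.1.1 w.1.2)%R.

Definition bridge_peak : R := (Num.sqrt (pi * s) ^- d)%R.

Lemma bridge_variance_gt0 : (0 < s)%R.
Proof. by rewrite !mulr_gt0// subr_gt0. Qed.

Lemma bridge_peak_gt0 : (0 < bridge_peak)%R.
Proof.
by rewrite invr_gt0 exprn_gt0// sqrtr_gt0 mulr_gt0 ?pi_gt0// bridge_variance_gt0.
Qed.

Lemma sqdist_bridge x y z :
  (sqdist x z / t + sqdist y z / (1 - t) =
   sqdist x y + sqdist (bridge_mean x y) z / (t * (1 - t)))%R.
Proof.
have t0 : t != 0%R by rewrite gt_eqF.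
have t1 : (1 - t)%R != 0%R by rewrite gt_eqF// subr_gt0.
rewrite /sqdist !mulr_suml -!big_split /=; apply: eq_bigr => i _.
by rewrite tnth_mktuple; field; rewrite t0 t1.
Qed.

Lemma sqdistC x y : sqdist x y = sqdist y x.
Proof. by apply: eq_bigr => i _; rewrite -sqrrN opprB. Qed.

Let powR_half (a : R) : (0 < a)%R -> (a `^ (- (d%:R / 2)) = Num.sqrt a ^- d)%R.
Proof.
move=> a0; rewrite powRN mulrC powRrM powR12_sqrt ?ltW//.
by rewrite powR_mulrn// sqrtr_ge0.
Qed.

Lemma bridgeE x y z :
  bridge ((x, y), z) =
  (bridge_peak * expR (- (sqdist (bridge_mean x y) z / s)))%R.
Proof.
have u_gt0 : (0 < 1 - t)%R by rewrite subr_gt0.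
have pe : (0 < pi * eps)%R by rewrite mulr_gt0// pi_gt0.
have ne : [/\ t != 0, 1 - t != 0 & eps != 0]%R by split; rewrite gt_eqF.
rewrite /bridge /heat_kernel /= !powR_half ?mulr1//; do ?exact: mulr_gt0.
set X := Num.sqrt (pi * eps * t)%R; set Y := Num.sqrt (pi * eps * (1 - t))%R.
set A := Num.sqrt (pi * eps)%R.
have A0 : (A ^+ d != 0)%R by rewrite expf_neq0// gt_eqF// sqrtr_gt0.
have XY : (X * Y = A * Num.sqrt (pi * s))%R.
  rewrite /X /Y /A -!sqrtrM ?mulr_ge0 ?pi_ge0 ?ltW//.
  by congr Num.sqrt; rewrite /bridge_variance; ring.
have peak : (X ^- d * Y ^- d / A ^- d = bridge_peak)%R.
  by rewrite -invfM -exprMn XY exprMn invfM mulrAC divff ?mul1r// invr_eq0.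
have -> : (sqdist (bridge_mean x y) z / s =
    sqdist x z / (t * eps) + sqdist z y / ((1 - t) * eps) -
    sqdist x y / (1 * eps))%R.
  have := sqdist_bridge x y z; rewrite (sqdistC z y) /bridge_variance.
  move=> /(congr1 (fun a => a / eps)%R) e; rewrite !mulrDl in e.
  have -> : (sqdist (bridge_mean x y) z / (eps * t * (1 - t)) =
      sqdist (bridge_mean x y) z / (t * (1 - t)) / eps)%R.
    by case: ne => t0 u0 e0; field; rewrite t0 u0 e0.
  have -> : (sqdist (bridge_mean x y) z / (t * (1 - t)) / eps =
     sqdist x z / t / eps + sqdist y z / (1 - t) / eps - sqdist x y / eps)%R.
    by rewrite e; ring.
  by case: ne => t0 u0 e0; field; rewrite t0 u0 e0.
rewrite -peak; set a := (sqdist x z / _)%R; set b := (sqdist z y / _)%R.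
set c := (sqdist x y / _)%R.
have -> : expR (- (a + b - c)) = (expR (- a) * expR (- b) / expR (- c))%R.
  by rewrite -expRN -!expRD; congr expR; ring.
by rewrite !invfM; ring.
Qed.

Lemma bridge_gt0 w : (0 < bridge w)%R.
Proof.
by case: w => -[x y] z; rewrite bridgeE mulr_gt0 ?expR_gt0// bridge_peak_gt0.
Qed.

Lemma measurable_bridge_mean : measurable_fun setT
  (fun v : Rn R d * Rn R d => bridge_mean v.1 v.2).
Proof.
apply/measurable_fun_tnthP => i.
rewrite (_ : _ \o _ = fun v : Rn R d * Rn R d =>
    ((1 - t) * tnth v.1 i + t * tnth v.2 i)%R); last first.
  by apply/funext => v; rewrite /= tnth_mktuple.
apply: measurable_funD; apply: measurable_funM => //.
  exact: (measurableT_comp (measurable_tnth i) measurable_fst).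
exact: (measurableT_comp (measurable_tnth i) measurable_snd).
Qed.

Lemma measurable_bridge : measurable_fun setT bridge.
Proof.
rewrite (_ : bridge = fun w =>
  (bridge_peak * expR (- (sqdist (bridge_mean w.1.1 w.1.2) w.2 / s)))%R); last first.
  by apply/funext => -[[x y] z]; rewrite bridgeE.
apply: measurable_funM => //; apply: measurableT_comp => //.
apply: measurableT_comp => //; apply: measurable_funM => //.
apply: measurable_sqdist; last exact: measurable_snd.
exact: (measurableT_comp measurable_bridge_mean measurable_fst).
Qed.

Lemma integral_bridge v : \int[lebesgue_Rn R d]_z (bridge (v, z))%:E = 1.
Proof.
case: v => x y; under eq_integral do rewrite bridgeE EFinM.
rewrite ge0_integralZl//; last 2 first.
- apply/measurable_EFinP; apply: measurableT_comp => //.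
  apply: measurableT_comp => //; apply: measurable_funM => //.
  exact: measurable_sqdist.
- by rewrite lee_fin ltW// bridge_peak_gt0.
rewrite gauss_integral_Rn ?bridge_variance_gt0// -EFinM mulVf//.
by rewrite expf_neq0// gt_eqF// sqrtr_gt0 mulr_gt0 ?pi_gt0// bridge_variance_gt0.
Qed.

Definition bridge_kappa : R := (eps * ln bridge_peak)%R.

Lemma psi_bridge x y z : (psi t x z + psi (1 - t) y z =
  sqdist x y - eps * ln (bridge ((x, y), z)) + bridge_kappa)%R.
Proof.
rewrite /psi sqdist_bridge bridgeE lnM ?posrE ?expR_gt0 ?bridge_peak_gt0//.
rewrite expRK /bridge_kappa /bridge_variance.
have u0 : (0 < 1 - t)%R by rewrite subr_gt0.
by field; rewrite !gt_eqF.
Qed.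

Definition bridge_bound : R :=
  (2 * eps * bridge_peak * Num.sqrt (pi * (2 * s)) ^+ d)%R.

(** The energy of the bridge has bounded mean, because
    [u * expR (- u) <= 2 * expR (- (u / 2))] reduces it to a Gaussian integral of
    doubled variance, whose value is [bridge_bound]. *)
Lemma bridge_cost_le v :
  \int[lebesgue_Rn R d]_z ((psi t v.1 z + psi (1 - t) v.2 z) * bridge (v, z))%:E
  <= (sqdist v.1 v.2 + bridge_bound)%:E.
Proof.
case: v => x y /=.
have s0 := bridge_variance_gt0; have p0 := bridge_peak_gt0.
have mgauss (a : R) : measurable_fun setT (fun z : Rn R d =>
    expR (- (sqdist (bridge_mean x y) z / a))).
  apply: measurableT_comp => //; apply: measurableT_comp => //.
  by apply: measurable_funM => //; exact: measurable_sqdist.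
have mb : measurable_fun setT (fun z => bridge ((x, y), z)).
  exact: (measurableT_comp measurable_bridge).
have mpsi : measurable_fun setT (fun z => psi t x z + psi (1 - t) y z)%R.
  by apply: measurable_funD; apply: measurable_funM => //; exact: measurable_sqdist.
have psi0 z : (0 <= psi t x z + psi (1 - t) y z)%R.
  by rewrite addr_ge0// divr_ge0 ?sqdist_ge0// ?subr_ge0 ltW.
have K0 : (0 <= 2 * eps * bridge_peak)%R by rewrite !mulr_ge0// ltW.
apply: (@le_trans _ _ (\int[lebesgue_Rn R d]_z
    ((sqdist x y)%:E * (bridge ((x, y), z))%:E +
     (2 * eps * bridge_peak)%:E *
       (expR (- (sqdist (bridge_mean x y) z / (2 * s))))%:E))).
  apply: ge0_le_integral => //.
  - by move=> z _; rewrite lee_fin mulr_ge0// ltW// bridge_gt0.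
  - by apply/measurable_EFinP; exact: measurable_funM.
  - by apply: emeasurable_funD; apply: emeasurable_funM => //; exact/measurable_EFinP.
  move=> z _; rewrite -!EFinM -EFinD lee_fin.
  rewrite /psi sqdist_bridge mulrDl lerD2l bridgeE.
  set u := (sqdist (bridge_mean x y) z / s)%R.
  have u0 : (0 <= u)%R by rewrite divr_ge0 ?sqdist_ge0// ltW.
  have -> : (sqdist (bridge_mean x y) z / (t * (1 - t)) = eps * u)%R.
    rewrite /u /bridge_variance; have u1 : (0 < 1 - t)%R by rewrite subr_gt0.
    by field; rewrite !gt_eqF.
  have -> : (sqdist (bridge_mean x y) z / (2 * s) = u / 2)%R.
    by rewrite /u; field; rewrite gt_eqF.
  have -> : expR (- u) = (expR (- (u / 2)) * expR (- (u / 2)))%R.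
    by rewrite -expRD; congr expR; lra.
  have h : (u / 2 * expR (- (u / 2)) <= 1)%R.
    rewrite -[leRHS](expRxMexpNx_1 (u / 2)) ler_wpM2r ?expR_ge0//.
    by have := expR_ge1Dx (u / 2)%R; lra.
  have c0 : (0 <= 2 * eps * bridge_peak * expR (- (u / 2)))%R.
    by rewrite mulr_ge0// expR_ge0.
  have := ler_wpM2l c0 h; rewrite mulr1; apply: le_trans.
  by rewrite le_eqVlt; apply/orP; left; apply/eqP; field.
rewrite ge0_integralD//; last 4 first.
- by move=> z _; rewrite -EFinM lee_fin mulr_ge0 ?sqdist_ge0// ltW// bridge_gt0.
- by apply: emeasurable_funM => //; exact/measurable_EFinP.
- by move=> z _; rewrite -EFinM lee_fin mulr_ge0// expR_ge0.
- by apply: emeasurable_funM => //; exact/measurable_EFinP.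
rewrite ge0_integralZl ?integral_bridge ?lee_fin ?sqdist_ge0//; last 2 first.
- exact/measurable_EFinP.
- by move=> z _; rewrite lee_fin ltW// bridge_gt0.
rewrite ge0_integralZl ?lee_fin//; last exact/measurable_EFinP.
have s2 : (0 < 2 * s)%R by move: s0; lra.
by rewrite gauss_integral_Rn// mule1 -EFinM -EFinD.
Qed.

End brownian_bridge.

Section second_moment.
Variable d : nat.
Implicit Types (x y z : Rn R d).

Definition sqnorm x : R := (\sum_(i < d) tnth x i ^+ 2)%R.

Lemma sqnorm_ge0 x : (0 <= sqnorm x)%R.
Proof. by apply: sumr_ge0 => i _; exact: sqr_ge0. Qed.

Lemma second_moment_has_expect (mu : probability (Rn R d) R) :
  finite_second_moment mu -> has_expect mu (fun x => 2 * sqnorm x)%R.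
Proof.
move=> mu2; apply: has_expectZ; apply: ge0_has_expect => //.
- apply: measurable_sum => i; apply: measurable_funX; exact: measurable_tnth.
- exact: sqnorm_ge0.
Qed.

Lemma sqdist_le x y : (sqdist x y <= 2 * sqnorm x + 2 * sqnorm y)%R.
Proof.
rewrite /sqnorm !mulr_sumr -big_split /=; apply: ler_sum => i _.
by have := sqr_ge0 (tnth x i + tnth y i); rewrite !expr2; nra.
Qed.

Lemma sqnorm_le x z : (sqnorm z <= 2 * sqnorm x + 2 * sqdist x z)%R.
Proof.
rewrite /sqnorm !mulr_sumr -big_split /=; apply: ler_sum => i _.
by have := sqr_ge0 (2 * tnth x i - tnth z i); rewrite !expr2; nra.
Qed.

(** A law whose logarithmic density is integrable for every midpoint law at
    finite transport cost from a law with finite second moment. *)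
Definition gauss_reference z : R :=
  (Num.sqrt (pi * 1) ^- d * expR (- sqnorm z))%R.

Let peak_gt0 : (0 < Num.sqrt (pi * 1) ^- d :> R)%R.
Proof. by rewrite invr_gt0 exprn_gt0// sqrtr_gt0 mulr1 pi_gt0. Qed.

Lemma gauss_reference_gt0 z : (0 < gauss_reference z)%R.
Proof. by rewrite mulr_gt0// expR_gt0. Qed.

Lemma measurable_gauss_reference : measurable_fun setT gauss_reference.
Proof.
apply: measurable_funM => //; apply: measurableT_comp => //.
apply: measurableT_comp => //; apply: measurable_sum => i.
by apply: measurable_funX; exact: measurable_tnth.
Qed.

Lemma integral_gauss_reference :
  \int[lebesgue_Rn R d]_z (gauss_reference z)%:E = 1.
Proof.
pose o : Rn R d := [tuple 0%R | i < d].
under eq_integral do rewrite EFinM.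
rewrite ge0_integralZl ?lee_fin ?ltW//; last first.
  apply/measurable_EFinP; apply: measurableT_comp => //.
  apply: measurableT_comp => //; apply: measurable_sum => i.
  by apply: measurable_funX; exact: measurable_tnth.
transitivity ((Num.sqrt (pi * 1) ^- d)%:E *
    \int[lebesgue_Rn R d]_z (expR (- (sqdist o z / 1)))%:E).
  congr (_ * _); apply: eq_integral => z _; congr (expR (- _))%:E.
  rewrite divr1; apply: eq_bigr => i _.
  by rewrite tnth_mktuple sub0r sqrrN.
rewrite gauss_integral_Rn// -EFinM mulVf// gt_eqF//.
by rewrite exprn_gt0// sqrtr_gt0 mulr1 pi_gt0.
Qed.

Lemma gauss_reference_lb (t : R) : (0 < t <= 1)%R ->
  exists C : R, forall x z, (- ln (gauss_reference z) <=
    C * (2 * sqnorm x + psi t x z + 1))%R.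
Proof.
move=> /andP[t0 t1]; pose l := ln (Num.sqrt (pi * 1) ^- d : R).
exists (2 + `|l|)%R => x z.
rewrite lnM ?posrE ?expR_gt0// -/l expRK.
have a0 := sqnorm_ge0 x; have b0 : (0 <= psi t x z)%R.
  by rewrite divr_ge0 ?sqdist_ge0// ltW.
have b1 : (sqdist x z <= psi t x z)%R.
  by rewrite /psi ler_peMr ?sqdist_ge0// invf_ge1.
have l0 := normr_ge0 l; have l1 : (- l <= `|l|)%R by rewrite -normrN ler_norm.
have := sqnorm_le x z; nra.
Qed.

End second_moment.

End euclidean.

(** * The entropic interpolant *)

Local Open Scope ring_scope.

Theorem proposition6p2 (R : realType) (d : nat)
    (mu nu : probability (Rn R d) R) (eps t : R)
    (pi_star : probability (Rn R d * Rn R d)%type R)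
    (mu2 : finite_second_moment mu) (nu2 : finite_second_moment nu)
    (eps_gt0 : 0 < eps) (t01 : 0 < t < 1)
    (pi_opt : is_optimal_plan eps (@sqdist R d) mu nu pi_star) :
  exists eta_t : probability (Rn R d) R,
    is_unique_minimizer (barycenter_functional eps t mu nu) eta_t /\
    has_density eta_t (lebesgue_Rn R d) (rho_SB eps t pi_star).
Proof.
have /andP[t_gt0 t_lt1] := t01.
have u_gt0 : 0 < 1 - t by rewrite Num.Theory.subr_gt0.
have mdist : measurable_fun setT (fun v : Rn R d * Rn R d => sqdist v.1 v.2).
  exact: measurable_sqdist measurable_fst measurable_snd.
have psi_ge0 (a : R) (x z : Rn R d) : 0 < a -> 0 <= psi a x z.
  by move=> a0; rewrite Num.Theory.divr_ge0 ?sqdist_ge0// Order.POrderTheory.ltW.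
have mpsi (a : R) : measurable_fun setT (fun v : Rn R d * Rn R d => psi a v.1 v.2).
  exact: measurable_funM.
have [|C rC] := @gauss_reference_lb R d t.
  by rewrite t_gt0 Order.POrderTheory.ltW.
exact: (@interpolation_minimizer _ _ _ _ _ _ R mu nu (lebesgue_Rn R d) eps
  (bridge_kappa d eps t) (bridge_bound d eps t) C (psi t) (psi (1 - t))
  (@sqdist R d) (bridge eps t) (@gauss_reference R d)
  (fun x => 2 * sqnorm x) (fun y => 2 * sqnorm y) eps_gt0
  (fun x z => psi_ge0 t x z t_gt0) (fun y z => psi_ge0 (1 - t) y z u_gt0)
  (@sqdist_ge0 R d) (mpsi t) (mpsi (1 - t)) mdist (@sqdist_le R d)
  (second_moment_has_expect mu2) (second_moment_has_expect nu2)
  (measurable_bridge eps_gt0 t_gt0 t_lt1) (bridge_gt0 eps_gt0 t_gt0 t_lt1)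
  (integral_bridge eps_gt0 t_gt0 t_lt1) (psi_bridge eps_gt0 t_gt0 t_lt1)
  (bridge_cost_le eps_gt0 t_gt0 t_lt1) (@measurable_gauss_reference R d)
  (@gauss_reference_gt0 R d) (eq_le1 (integral_gauss_reference R d)) rC
  pi_star pi_opt).
Qed.
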